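(* Let $(\Sigma,\omega)$ be a tropical $d$-fan in $N_{\mathbb{R}}$, let $*\in\mathrm{Inn}(N_{\mathbb{R}})$ be an inner product, and let $z_1,\dots,z_d\in\overline{\mathrm{Cub}}(\Sigma,* )$ be pseudocubical values. Then $$\mathrm{MVol}_{\Sigma,\omega,*}(z_1,\dots,z_d)=\deg_{\Sigma,\omega}(D(z_1)\cdots D(z_d)).$$
   Context: **Fans.** $N_{\mathbb{R}}$ is a finite-dimensional real vector space with dual $M_{\mathbb{R}}$ and pairing $\langle-,-\rangle$. All fans are (finite) polyhedral fans that are pure (all maximal cones have the same dimension) and marked (a generator $0\neq u_\rho\in\rho$ is chosen for each ray $\rho$). A $d$-fan is such a fan of dimension $d$. $\Sigma(k)$ is the set of $k$-dimensional cones, $\sigma(1)$ the set of rays of $\sigma$, $N_{\sigma,\mathbb{R}}$ the linear span of $\sigma$. $\Sigma$ is simplicial if $\dim N_{\sigma,\mathbb{R}}=|\sigma(1)|$ for all $\sigma\in\Sigma$. For $\tau\preceq\sigma$, $\sigma\setminus\tau$ is the face of $\sigma$ with rays $\sigma(1)\setminus\tau(1)$. A tropical $d$-fan $(\Sigma,\omega)$ is a simplicial $d$-fan $\Sigma$ with a weight function $\omega:\Sigma(d)\to\mathbb{R}_{>0}$ such that for all $\tau\in\Sigma(d-1)$, $\sum_{\sigma\in\Sigma(d),\,\tau\prec\sigma}\omega(\sigma)u_{\sigma\setminus\tau}\in N_{\tau,\mathbb{R}}$. $\mathrm{Inn}(N_{\mathbb{R}})$ is the set of inner products on $N_{\mathbb{R}}$.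 **Chow ring.** $A^\bullet(\Sigma)=\mathbb{R}[x_\rho\mid\rho\in\Sigma(1)]/(\mathcal{I}+\mathcal{J})$, where $\mathcal{I}$ is generated by the monomials $x_{\rho_1}\cdots x_{\rho_k}$ with $\mathbb{R}_{\ge0}\{\rho_1,\dots,\rho_k\}\notin\Sigma$ and $\mathcal{J}$ is generated by $\sum_{\rho\in\Sigma(1)}\langle v,u_\rho\rangle x_\rho$ for $v\in M_{\mathbb{R}}$. It is graded by degree; $X_\rho=[x_\rho]\in A^1(\Sigma)$. $A^d(\Sigma)$ is spanned by $X_\sigma=\prod_{\rho\in\sigma(1)}X_\rho$, $\sigma\in\Sigma(d)$, and for $(\Sigma,\omega)$ tropical, $\deg_{\Sigma,\omega}:A^d(\Sigma)\to\mathbb{R}$ is the (well-defined) linear map with $\deg_{\Sigma,\omega}(X_\sigma)=\omega(\sigma)$ for all $\sigma\in\Sigma(d)$. For $z\in\mathbb{R}^{\Sigma(1)}$, $D(z)=\sum_{\rho\in\Sigma(1)}z_\rho X_\rho\in A^1(\Sigma)$. **Mixed volumes.** For $z\in\mathbb{R}^{\Sigma(1)}$ and $\sigma\in\Sigma$, $w_{\sigma,*}(z)\in N_{\sigma,\mathbb{R}}$ is the unique vector with $w_{\sigma,*}(z)*u_\rho=z_\rho$ for all $\rho\in\sigma(1)$. $\overline{\mathrm{Cub}}(\Sigma,* )$ (pseudocubical values) is the set of $z$ with $w_{\sigma,*}(z)\in\sigma$ for all $\sigma\in\Sigma$. Let $P_{\sigma,*}(z)=\{v\in\sigma\mid v*u_\rho\le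 z_\rho\text{ for all }\rho\in\sigma(1)\}$. Let $M_\sigma\subseteq N_{\sigma,\mathbb{R}}$ be the lattice spanned by the basis dual to $\{u_\rho\mid\rho\in\sigma(1)\}$ with respect to $*$; $\mathrm{Vol}_\sigma$ is the volume on $N_{\sigma,\mathbb{R}}$ normalized so that a fundamental simplex of $M_\sigma$ (convex hull of $0$ and a lattice basis) has volume $1$, and $\mathrm{MVol}_\sigma$ is the associated mixed volume of polytopes (symmetric, Minkowski-multilinear, $\mathrm{MVol}_\sigma(P,\dots,P)=\mathrm{Vol}_\sigma(P)$). Then $$\mathrm{MVol}_{\Sigma,\omega,*}(z_1,\dots,z_d)=\sum_{\sigma\in\Sigma(d)}\omega(\sigma)\mathrm{MVol}_\sigma(P_{\sigma,*}(z_1),\dots,P_{\sigma,*}(z_d)).$$ *)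

(* Defs.v *)
From HB Require Import structures.
From mathcomp Require Import all_boot all_order all_fingroup all_algebra.
From mathcomp Require Import finmap mpoly.
From mathcomp Require Import boolp classical_sets reals ereal.
From mathcomp Require Import numfun measure lebesgue_measure lebesgue_integral.

Set Implicit Arguments.
Unset Strict Implicit.
Unset Printing Implicit Defensive.

Import Order.TTheory GRing.Theory Num.Theory.
Local Open Scope classical_set_scope.
Local Open Scope ring_scope.

Section ConvexGeometry.
Context {R : realType} {N : vectType R}.
Implicit Types (A B C : set N) (s : seq N).

(* The linear span of an arbitrary subset; [lspanP] shows that the choice
   always succeeds. *)
Definition is_lspan A (V : {vspace N}) : Prop :=
  (forall v, A v -> v \in V) /\
  (forall W : {vspace N}, (forall v, A v -> v \in W) -> (V <= W)%VS).

Definition lspan A : {vspace N} := xget 0%VS [set V | is_lspan A V].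

Lemma lspanP A : is_lspan A (lspan A).
Proof.
apply: (@xgetPex _ _ [set V | is_lspan A V]).
pose hasdim n := `[< exists V : {vspace N},
                       (forall v, A v -> v \in V) /\ \dim V = n >].
have ex_n : exists n, hasdim n.
  exists (\dim (@fullv _ N)); apply/asboolP; exists fullv.
  by split=> // v _; rewrite memvf.
case: (ex_minnP ex_n) => n /asboolP[V [AV dimV]] min_n.
exists V; split=> // W AW.
have dimVW : (\dim V <= \dim (V :&: W))%N.
  rewrite dimV; apply: min_n; apply/asboolP.
  by exists (V :&: W)%VS; split=> // v Av; rewrite memv_cap AV // AW.
have /eqP <- : (V :&: W == V)%VS by rewrite eqEdim capvSl dimVW.
exact: capvSr.
Qed.

Definition cdim A : nat := \dim (lspan A).

Definition cone_of s : set N :=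
  [set v | exists2 c : 'I_(size s) -> R,
     forall i, 0 <= c i & v = \sum_i c i *: s`_i].

Definition conv_hull s : set N :=
  [set v | exists c : 'I_(size s) -> R,
     [/\ forall i, 0 <= c i, \sum_i c i = 1 & v = \sum_i c i *: s`_i]].

Definition polyhedral_cone C : Prop := exists s, C = cone_of s.

Definition pointed C : Prop := forall v, C v -> C (- v) -> v = 0.

(* Faces as extremal subcones; for polyhedral cones these are the same as
   the intersections with supporting hyperplanes. *)
Definition face B C : Prop :=
  [/\ B `<=` C, B 0,
      forall a b x y, 0 <= a -> 0 <= b -> B x -> B y -> B (a *: x + b *: y)
    & forall x y, C x -> C y -> B (x + y) -> B x /\ B y].

Definition polytope A : Prop := exists2 s, s != [::] & A = conv_hull s.

Definition minkowski_comb (a b : R) A B : set N :=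
  [set v | exists x y, [/\ A x, B y & v = a *: x + b *: y]].

End ConvexGeometry.

Definition rays_of (R : realType) (N : vectType R) (F : {fset set N}) :
  {fset set N} := [fset C in F | cdim C == 1%N]%fset.

Record fan (R : realType) (N : vectType R) := Fan {
  cones :> {fset set N};
  fan_nonempty : exists C, C \in cones;
  fan_polyhedral : forall C, C \in cones -> polyhedral_cone C;
  fan_pointed : forall C, C \in cones -> pointed C;
  fan_face : forall B C, C \in cones -> face B C -> B \in cones;
  fan_meet : forall B C, B \in cones -> C \in cones -> face (B `&` C) B;
  mark : rays_of cones -> N;
  markP : forall rho : rays_of cones, (val rho) (mark rho) /\ mark rho != 0
}.

Notation rays Sigma := (rays_of (cones Sigma)).

Section Fans.
Context {R : realType} {N : vectType R}.
Variable Sigma : fan N.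
Implicit Types (C : set N) (rho : rays Sigma).

Definition cones_dim (d : nat) : {fset set N} :=
  [fset C in cones Sigma | cdim C == d]%fset.

Definition cone_rays C : pred (rays Sigma) :=
  fun rho => `[< face (val rho) C >].

(* [C \ B] is the face of [C] with rays [C(1) \ B(1)]; when [B] is a facet of
   a simplicial cone [C] it is a single ray, the sum has exactly one term and
   [mark_diff C B] is the marked generator of [C \ B]. *)
Definition mark_diff C B : N :=
  \sum_(rho | cone_rays C rho && ~~ cone_rays B rho) mark rho.

Definition pure_of_dim (d : nat) : Prop :=
  forall C, C \in cones Sigma ->
    (forall B, B \in cones Sigma -> C `<=` B -> B = C) -> cdim C = d.

Definition simplicial : Prop :=
  forall C, C \in cones Sigma -> cdim C = #|cone_rays C|.

Definition balanced (d : nat) (omega : cones_dim d -> R) : Prop :=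
  forall B, B \in cones Sigma -> (cdim B).+1 = d ->
    \sum_(C : cones_dim d | `[< face B (val C) >])
       omega C *: mark_diff (val C) B \in lspan B.

Definition tropical (d : nat) (omega : cones_dim d -> R) : Prop :=
  [/\ pure_of_dim d, simplicial, forall C : cones_dim d, 0 < omega C
    & balanced omega].

End Fans.

Section ChowRing.
Context {R : realType} {N : vectType R}.
Variable Sigma : fan N.

Local Notation ray_poly := {mpoly R[#|{: rays Sigma}|]}.

Definition ray_var (rho : rays Sigma) : ray_poly := 'X_(enum_rank rho).

Definition chow_monomials : set ray_poly :=
  [set p | exists2 s : seq (rays Sigma),
     cone_of [seq mark rho | rho <- s] \notin cones Sigma &
     p = \prod_(rho <- s) ray_var rho].

Definition chow_linear_forms : set ray_poly :=
  [set p | exists m : 'Hom(N, R^o),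
     p = \sum_(rho : rays Sigma) (m (mark rho) : R) *: ray_var rho].

Definition chow_ideal : set ray_poly :=
  [set p | exists2 s : seq (ray_poly * ray_poly),
     forall q, q \in s -> (chow_monomials `|` chow_linear_forms) q.2 &
     p = \sum_(q <- s) q.1 * q.2].

Definition chow_idealb : ray_poly -> bool := fun p => `[< chow_ideal p >].

Lemma fan_zero : [set 0] \in cones Sigma.
Proof.
have [C CS] := fan_nonempty Sigma; apply: (fan_face CS).
have [s Cs] := fan_polyhedral CS.
split.
- move=> v /= ->; rewrite Cs; exists (fun=> 0) => // .
  by rewrite big1 // => i _; rewrite scale0r.
- by [].
- by move=> a b x y _ _ /= -> ->; rewrite !scaler0 addr0.
- move=> x y Cx Cy /= xy0.
  have yE : y = - x by apply/eqP; rewrite -addr_eq0 addrC xy0.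
  have x0 : x = 0 by apply: (fan_pointed CS Cx); rewrite -yE.
  by rewrite yE x0 oppr0.
Qed.

Lemma chow_ideal_at0 (p : ray_poly) : chow_ideal p -> p.@[fun=> 0] = 0.
Proof.
case=> s sG ->; rewrite raddf_sum /= big_seq big1 // => q qs.
rewrite mevalM; suff -> : q.2.@[fun=> 0] = 0 by rewrite mulr0.
case: (sG q qs) => [[[|rho l] lS ->]|[m ->]].
- case/negP: lS; suff -> : cone_of [::] = [set 0 : N] by exact: fan_zero.
  apply/seteqP; split=> v /=.
    by case=> c _ ->; rewrite big_ord0.
  by move=> ->; exists (fun=> 0) => //; rewrite big_ord0.
- by rewrite big_cons mevalM mevalXU mul0r.
- rewrite raddf_sum /= big1 // => rho _.
  by rewrite mevalZ mevalXU mulr0.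
Qed.

Lemma chow_ideal_closed : idealr_closed chow_idealb.
Proof.
split.
- by apply/asboolP; exists [::] => //; rewrite big_nil.
- apply/negP => /asboolP /chow_ideal_at0 /eqP.
  by rewrite meval1 oner_eq0.
- move=> a u v /asboolP[s sG ->] /asboolP[t tG ->]; apply/asboolP.
  exists ([seq (a * q.1, q.2) | q <- s] ++ t).
    move=> q; rewrite mem_cat => /orP[/mapP[q1 q1s ->]|qt].
      exact: (sG _ q1s).
    exact: (tG _ qt).
  rewrite big_cat big_map mulr_sumr; congr (_ + _).
  by apply: eq_bigr => q _; rewrite mulrA.
Qed.

HB.instance Definition _ := isIdealr.Build ray_poly chow_idealb chow_ideal_closed.

Definition chow_idealr : idealr ray_poly := chow_idealb.
Definition chow : Type := {ideal_quot chow_idealr}.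
HB.instance Definition _ := GRing.ComNzRing.on chow.

Definition chow_class (p : ray_poly) : chow :=
  \pi_({ideal_quot chow_idealr})%qT p.

Lemma chow_classB : {morph chow_class : p q / p - q}.
Proof. exact: (rmorphB (\pi_({ideal_quot chow_idealr})%qT)). Qed.

Lemma chow_class_monoid : monoid_morphism chow_class.
Proof.
split; first exact: (rmorph1 (\pi_({ideal_quot chow_idealr})%qT)).
exact: (rmorphM (\pi_({ideal_quot chow_idealr})%qT)).
Qed.

HB.instance Definition _ :=
  GRing.isZmodMorphism.Build ray_poly chow chow_class chow_classB.
HB.instance Definition _ :=
  GRing.isMonoidMorphism.Build ray_poly chow chow_class chow_class_monoid.

Lemma chow_class_eq0 p : chow_class p = 0 <-> chow_ideal p.
Proof.
have E := Quotient.idealrBE chow_idealr p 0; rewrite subr0 in E.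
rewrite -(rmorph0 chow_class); split=> [/eqP|] pI.
  by apply/asboolP; change (p \in chow_idealr); rewrite E.
apply/eqP; change (p == 0 %[mod {ideal_quot chow_idealr}])%qT.
by rewrite -E; apply/asboolP.
Qed.

Definition chow_scale (c : R) (a : chow) : chow := chow_class c%:MP * a.

Lemma chow_scaleA c e a : chow_scale c (chow_scale e a) = chow_scale (c * e) a.
Proof. by rewrite /chow_scale mulrA -rmorphM -mpolyCM. Qed.
Lemma chow_scale1 : left_id 1 chow_scale.
Proof. by move=> a; rewrite /chow_scale mpolyC1 rmorph1 mul1r. Qed.
Lemma chow_scaleDr : right_distributive chow_scale +%R.
Proof. by move=> c a b; rewrite /chow_scale mulrDr. Qed.
Lemma chow_scaleDl a : {morph chow_scale^~ a : c e / c + e}.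
Proof. by move=> c e; rewrite /chow_scale mpolyCD rmorphD mulrDl. Qed.

HB.instance Definition _ := GRing.Zmodule_isLmodule.Build R chow
  chow_scaleA chow_scale1 chow_scaleDr chow_scaleDl.

Lemma chow_scaleAl (c : R) (a b : chow) : c *: (a * b) = c *: a * b.
Proof. exact: mulrA. Qed.
HB.instance Definition _ := GRing.Lmodule_isLalgebra.Build R chow chow_scaleAl.
Lemma chow_scaleAr (c : R) (a b : chow) : c *: (a * b) = a * (c *: b).
Proof. exact: mulrCA. Qed.
HB.instance Definition _ := GRing.Lalgebra_isAlgebra.Build R chow chow_scaleAr.

Definition chow_graded (k : nat) : set chow :=
  [set a | exists2 p : ray_poly, p \is k.-homog & a = chow_class p].

Definition chow_ray (rho : rays Sigma) : chow := chow_class (ray_var rho).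

Definition chow_cone (C : set N) : chow :=
  \prod_(rho | cone_rays C rho) chow_ray rho.

Definition divisor (z : rays Sigma -> R) : chow :=
  \sum_rho z rho *: chow_ray rho.

(* The degree map, a linear map on the graded piece [chow_graded d]; its values
   elsewhere are unconstrained. *)
Definition is_degree_map (d : nat) (omega : cones_dim Sigma d -> R)
    (deg : chow -> R) : Prop :=
  (forall (c : R) a b, chow_graded d a -> chow_graded d b ->
     deg (c *: a + b) = c * deg a + deg b) /\
  (forall C : cones_dim Sigma d, deg (chow_cone (val C)) = omega C).

End ChowRing.

Section MixedVolumes.
Context {R : realType} {N : vectType R}.

(* Lebesgue measure of R^k, as an iterated integral (the formula defining the
   iterated product measure). *)
Fixpoint lebesgue_tuple (k : nat) : set (k.-tuple R) -> \bar R :=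
  match k with
  | 0 => fun A => (\1_A [tuple])%:E
  | k'.+1 => fun A =>
      (\int[@lebesgue_measure R]_x
         lebesgue_tuple [set t : k'.-tuple R | A [tuple of x :: t]])%E
  end.

(* [MV] is symmetric, Minkowski-multilinear and has diagonal [vol] on the
   polytopes contained in [V]; there is exactly one such function on them.
   Polytopes are nonempty, so [0 * A] is the point [0]. *)
Definition is_mixed_volume (V : {vspace N}) (vol : set N -> R) (d : nat)
    (MV : ('I_d -> set N) -> R) : Prop :=
  let polytope_in P := polytope P /\ (forall v, P v -> v \in V) in
  [/\ forall (P : 'I_d -> set N) (s : {perm 'I_d}),
        (forall i, polytope_in (P i)) -> MV (P \o s) = MV P,
      forall (P : 'I_d -> set N) (i : 'I_d) (A B : set N) (a b : R),
        (forall j, polytope_in (P j)) -> polytope_in A -> polytope_in B ->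
        0 <= a -> 0 <= b ->
        let subst Q := fun j => if j == i then Q else P j in
        MV (subst (minkowski_comb a b A B)) =
          a * MV (subst A) + b * MV (subst B)
    & forall P : set N, polytope_in P -> MV (fun=> P) = vol P].

Variables (Sigma : fan N) (ip : {dot N for @idfun R}).
Implicit Types (z : rays Sigma -> R) (C : set N).

(* w_{C,*}(z); the default value is never used when [C] is a cone of a
   simplicial fan. *)
Definition normal_point C z : N :=
  xget 0 [set w | w \in lspan C /\
                  forall rho, cone_rays C rho -> ip w (mark rho) = z rho].

Definition pseudocubical z : Prop :=
  forall C, C \in cones Sigma -> C (normal_point C z).

Definition normal_polytope C z : set N :=
  [set v | C v /\ forall rho, cone_rays C rho -> ip v (mark rho) <= z rho].

Definition dual_vector C (rho : rays Sigma) : N :=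
  normal_point C (fun rho' => (rho' == rho)%:R).

Definition dual_basis C : seq N :=
  [seq dual_vector C rho | rho <- enum (cone_rays C)].

(* [dual_basis C] is a basis of the lattice M_C; the volume below is Lebesgue
   measure in the coordinates it gives on the span of [C]. *)
Definition lattice_volume C (A : set N) : R :=
  fine (lebesgue_tuple
    [set t : (size (dual_basis C)).-tuple R |
       A (\sum_i tnth t i *: (dual_basis C)`_i)]).

(* Normalized so that the fundamental simplex of M_C has volume 1. *)
Definition cone_volume C (A : set N) : R :=
  lattice_volume C A / lattice_volume C (conv_hull (0 :: dual_basis C)).

Definition fan_mixed_volume (d : nat) (omega : cones_dim Sigma d -> R)
    (MV : cones_dim Sigma d -> ('I_d -> set N) -> R)
    (z : 'I_d -> rays Sigma -> R) : R :=
  \sum_(C : cones_dim Sigma d)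
    omega C * MV C (fun i => normal_polytope (val C) (z i)).

End MixedVolumes.

(* Main.v *)
(** Fix a maximal cone with marked generators [u i].  The polytope [P(z)] of a
pseudocubical [z] is the convex hull of the points [w tau] (a ray from the
origin leaves it through a facet, which is again such a polytope after
projecting along [u i], with [z j] replaced by
[z j - z i * (u i * u j) / (u i * u i)]).  Cutting it into pyramids over its
facets gives [Vol(P(z)) = sum_i z i * Vol(P(z^i))], where [z^i] are the
projected values.  In the Chow ring [D(z) = D(z^i)], since the difference is a
linear form, so [D(z)^d = sum_i z i * X_i * D(z^i)^(d-1)]: the degree of
[D(z)^d] obeys the same recursion, one cone at a time.  This settles the case
of equal arguments.  Both sides are symmetric and multilinear on pseudocubical
values, because [P(a z + b z') = a P(z) + b P(z')] follows from the description
by the [w tau], and polarization concludes. *)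

Require Import Defs.
From HB Require Import structures.
From mathcomp Require Import all_boot all_order all_fingroup all_algebra.
From mathcomp Require Import finmap mpoly boolp classical_sets reals.
From mathcomp Require Import cardinality functions ereal normedtype derive.
From mathcomp Require Import numfun measure.
From mathcomp Require Import lebesgue_measure lebesgue_integral ftc.
From mathcomp Require Import measurable_realfun realfun.
From mathcomp Require Import ring lra zify.

Set Implicit Arguments.
Unset Strict Implicit.
Unset Printing Implicit Defensive.

Import Order.TTheory GRing.Theory Num.Theory.
Import numFieldNormedType.Exports.
Local Open Scope ring_scope.

(** * Iterated Lebesgue measure *)

Section Insert.
Context {T : Type}.

(** The iterated integral [lebesgue_tuple] is handled only through slicing along a coordinate,
    additivity on disjoint sets, and scaling with translation. Two choices keep the volume
    computation within these means. A point [v] of a cone is recorded by the numbers [ip v (u j)],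
    its coordinates in the dual basis: a facet becomes a coordinate slice and its projection along
    [u i] a translation, so no determinant appears. The pyramids are made exactly disjoint by
    removing facets, so the volume formula is proved for polytopes with any set of such facets
    removed.

    Both sides meet in the recursive number [vol_poly], which is [d!] times Lebesgue measure. On the
    Chow side the projected value vanishes on the ray just used, so every monomial that contributes
    is a product of distinct rays, hence a cone or zero.

    Pseudocubicality enters through the points [w tau] alone: they survive projection to a facet and
    add up under nonnegative combinations. Only such combinations being available, polarization
    compares polynomials in a scalar at nonnegative arguments. *)

Definition insert_tuple k (i : 'I_k.+1) (x : T) (t : k.-tuple T) :
  k.+1.-tuple T :=
  [tuple if unlift i j is Some j' then tnth t j' else x | j < k.+1].

Lemma tnth_insert k (i : 'I_k.+1) x (t : k.-tuple T) :
  tnth (insert_tuple i x t) i = x.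
Proof. by rewrite tnth_mktuple unlift_none. Qed.

Lemma tnth_insert_lift k (i : 'I_k.+1) x (t : k.-tuple T) j :
  tnth (insert_tuple i x t) (lift i j) = tnth t j.
Proof. by rewrite tnth_mktuple liftK. Qed.

Lemma insert_tuple0 k x (t : k.-tuple T) :
  insert_tuple ord0 x t = [tuple of x :: t].
Proof.
apply: eq_from_tnth => j; case: (unliftP ord0 j) => [j' ->|->].
  by rewrite tnth_insert_lift tnthS.
by rewrite tnth_insert tnth0.
Qed.

Lemma insert_tuple_lift k (i : 'I_k.+1) x y (t : k.-tuple T) :
  insert_tuple (lift ord0 i) x [tuple of y :: t] =
  [tuple of y :: insert_tuple i x t].
Proof.
apply: eq_from_tnth => j; case: (unliftP (lift ord0 i) j) => [j' ->|->].
  rewrite tnth_insert_lift; case: (unliftP ord0 j') => [j'' ->|->].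
    have -> : lift (lift ord0 i) (lift ord0 j'') = lift ord0 (lift i j'').
      by apply: val_inj; rewrite /= /bump /= !add1n ltnS; case: leqP.
    by rewrite !tnthS tnth_insert_lift.
  have -> : lift (lift ord0 i) ord0 = ord0 by apply: val_inj.
  by rewrite !tnth0.
by rewrite tnth_insert tnthS tnth_insert.
Qed.

End Insert.

Section LebesgueTuple.
Local Open Scope classical_set_scope.
Context {R : realType}.
Local Notation RR := (measurableTypeR R).
Local Notation mu := (@lebesgue_measure R).

(** The sigma-algebra sits on tuples over [measurableTypeR R], while [lebesgue_tuple] takes sets of
    tuples over [R]. *)
Definition measurable_tset k (A : set (k.-tuple R)) := @measurable _ (k.-tuple RR) A.

Lemma measurable_insert k (i : 'I_k.+1) d (T : measurableType d)
    (f : T -> RR) (g : T -> k.-tuple RR) :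
  measurable_fun setT f -> measurable_fun setT g ->
  measurable_fun setT (fun x => insert_tuple i (f x) (g x)).
Proof.
move=> mf mg; apply/measurable_fun_tnthP => j.
case: (unliftP i j) => [j' ->|->].
  rewrite (_ : _ \o _ = fun x => tnth (g x) j').
    exact: (measurableT_comp (measurable_tnth j') mg).
  by apply/funext => x /=; rewrite tnth_insert_lift.
by rewrite (_ : _ \o _ = f) //; apply/funext => x /=; rewrite tnth_insert.
Qed.

Lemma measurable_tset_insert k (i : 'I_k.+1) (x : R) A :
  measurable_tset A -> measurable_tset [set t | A (insert_tuple i x t)].
Proof.
move=> mA; rewrite /measurable_tset -[X in measurable X]setTI.
have := @measurable_insert k i _ (k.-tuple RR) (cst x) id.
by apply.
Qed.

Lemma measurable_tset_cons k (x : R) (A : set (k.+1.-tuple R)) :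
  measurable_tset A -> measurable_tset [set t : k.-tuple R | A [tuple of x :: t]].
Proof.
move=> mA; rewrite (_ : mkset _ = [set t | A (insert_tuple ord0 x t)]).
  exact: measurable_tset_insert.
by apply/funext => t; rewrite /= insert_tuple0.
Qed.

Lemma lebesgue_tuple_ge0 k (A : set (k.-tuple R)) : (0 <= lebesgue_tuple A)%E.
Proof.
elim: k A => [|k IH] A /=; first by rewrite lee_fin.
by apply: integral_ge0 => x _; exact: IH.
Qed.

(** The parameter space [T] is arbitrary so that the induction can move the first coordinate of the
    tuple into it; what remains is the measurability part of Tonelli's theorem. *)
Lemma measurable_lebesgue_section k d (T : measurableType d)
    (A : set (T * k.-tuple RR)) :
  measurable A ->
  measurable_fun setT (fun x => lebesgue_tuple [set t : k.-tuple R | A (x, t)]).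
Proof.
elim: k d T A => [|k IH] d T A mA /=.
  apply/measurable_EFinP.
  rewrite (_ : (fun x => _) = \1_A \o (fun x : T => (x, [tuple]%R : 0.-tuple RR))).
    by apply: measurableT_comp => //; exact: measurable_pair2.
  by apply/funext => x /=; rewrite !indicE; congr (_%:R); apply/idP/idP; rewrite !inE.
have mA' : measurable [set p : (T * RR) * k.-tuple RR |
    A (p.1.1, [tuple of p.1.2 :: p.2])].
  rewrite -[X in measurable X]setTI.
  suff : measurable_fun setT
    (fun p : (T * RR) * k.-tuple RR => (p.1.1, [the k.+1.-tuple RR of p.1.2 :: p.2])).
    by apply.
  apply/measurable_fun_pair.
    exact: (measurableT_comp measurable_fst measurable_fst).
  apply: measurable_cons; last exact: measurable_snd.
  exact: (measurableT_comp measurable_snd measurable_fst).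
have := IH _ _ _ mA'.
move=> /(@measurable_fun_fubini_tonelli_F _ _ T RR R mu _).
apply => p; exact: lebesgue_tuple_ge0.
Qed.

Lemma measurable_lebesgue_insert k (i : 'I_k.+1) (A : set (k.+1.-tuple R)) :
  measurable_tset A ->
  measurable_fun setT
    (fun x : RR => lebesgue_tuple [set t | A (insert_tuple i x t)]).
Proof.
move=> mA.
apply: (@measurable_lebesgue_section _ _ RR
  [set p : RR * k.-tuple RR | A (insert_tuple i p.1 p.2)]).
rewrite -[X in measurable X]setTI.
have mi := @measurable_insert k i _ (RR * k.-tuple RR)%type fst snd.
by move: (mi measurable_fst measurable_snd); apply.
Qed.

Lemma measurable_lebesgue_cons k (A : set (k.+1.-tuple R)) :
  measurable_tset A ->
  measurable_fun setT
    (fun x : RR => lebesgue_tuple [set t : k.-tuple R | A [tuple of x :: t]]).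
Proof.
move=> mA.
rewrite (_ : (fun x => _) =
  (fun x => lebesgue_tuple [set t | A (insert_tuple ord0 x t)])).
  exact: measurable_lebesgue_insert.
apply/funext => x; congr lebesgue_tuple; apply/funext => t.
by rewrite /= insert_tuple0.
Qed.

Lemma lebesgue_tuple_cons k (A : set (k.+1.-tuple R)) : lebesgue_tuple A =
  (\int[mu]_x lebesgue_tuple [set t : k.-tuple R | A [tuple of x :: t]])%E.
Proof. by []. Qed.

(** Induction brings the chosen coordinate out of each slice at a fixed first coordinate, and
    Tonelli's theorem exchanges the two outer integrals. *)
Lemma lebesgue_tuple_insert k (i : 'I_k.+1) (A : set (k.+1.-tuple R)) :
  measurable_tset A ->
  lebesgue_tuple A =
    (\int[mu]_x lebesgue_tuple [set t | A (insert_tuple i x t)])%E.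
Proof.
have ins0 j (B : set (j.+1.-tuple R)) : lebesgue_tuple B =
    (\int[mu]_x lebesgue_tuple [set t | B (insert_tuple ord0 x t)])%E.
  rewrite lebesgue_tuple_cons; apply: eq_integral => x _; congr lebesgue_tuple.
  by apply/funext => t /=; rewrite insert_tuple0.
elim: k i A => [|k IH] i A mA; first by rewrite ord1.
case: (unliftP ord0 i) => [i' ->|->]; last exact: ins0.
rewrite lebesgue_tuple_cons.
under eq_integral => x _ do rewrite (IH i' _ (measurable_tset_cons x mA)).
rewrite (@fubini_tonelli _ _ RR RR R mu mu (fun p => lebesgue_tuple
  [set t : k.-tuple R | A [tuple of p.1 :: insert_tuple i' p.2 t]])).
- apply: eq_integral => x _; apply: eq_integral => y _.
  congr lebesgue_tuple; apply/funext => t /=.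
  by rewrite insert_tuple_lift.
- apply: (@measurable_lebesgue_section _ _ (RR * RR)%type
    [set p : (RR * RR) * k.-tuple RR |
       A [tuple of p.1.1 :: insert_tuple i' p.1.2 p.2]]).
  rewrite -[X in measurable X]setTI.
  suff : measurable_fun setT (fun p : (RR * RR) * k.-tuple RR =>
     [the k.+2.-tuple RR of p.1.1 :: insert_tuple i' p.1.2 p.2]) by apply.
  apply: measurable_cons.
    exact: (measurableT_comp measurable_fst measurable_fst).
  apply: measurable_insert; last exact: measurable_snd.
  exact: (measurableT_comp measurable_snd measurable_fst).
- by move=> p; exact: lebesgue_tuple_ge0.
Qed.

Lemma lebesgue_tuple_setU k (A B : set (k.-tuple R)) :
  measurable_tset A -> measurable_tset B -> A `&` B = set0 ->
  lebesgue_tuple (A `|` B) = (lebesgue_tuple A + lebesgue_tuple B)%E.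
Proof.
elim: k A B => [|k IH] A B mA mB AB0 /=.
  rewrite -EFinD; congr (_%:E); rewrite !indicE in_setU.
  have := AB0; rewrite -subset0 => /(_ [tuple]) /=.
  case: (boolP (_ \in A)); case: (boolP (_ \in B)); rewrite ?inE /= ?addr0 ?add0r //.
  by move=> a b /(_ (conj b a)).
rewrite -ge0_integralD //; first last.
- exact: measurable_lebesgue_cons.
- by move=> x _; exact: lebesgue_tuple_ge0.
- exact: measurable_lebesgue_cons.
- by move=> x _; exact: lebesgue_tuple_ge0.
apply: eq_integral => x _; rewrite -IH //; try exact: measurable_tset_cons.
by apply/seteqP; split=> t //= [a b]; have : (A `&` B) [tuple of x :: t] by []; rewrite AB0.
Qed.

Lemma lebesgue_tuple0 k : lebesgue_tuple (set0 : set (k.-tuple R)) = 0%E.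
Proof.
elim: k => [|k IH] /=; first by rewrite indicE in_set0.
by under eq_integral do rewrite (_ : [set _ | _] = set0) // IH; rewrite integral0.
Qed.

End LebesgueTuple.

(** * Affine substitution and integrals in one variable *)

Section Lebesgue1.
Local Open Scope classical_set_scope.
Context {R : realType}.
Local Notation RR := (measurableTypeR R).
Local Notation mu := (@lebesgue_measure R).

Lemma measurable_affine (c b : R) : measurable_fun setT (fun x : RR => c * x + b : RR).
Proof. exact/measurable_funD/measurable_cst/measurable_funM. Qed.

(** The left side is a measure in [A], so uniqueness of Lebesgue measure reduces the claim to
    half-open intervals. For negative [c] the preimage is closed at the other end, with the same
    length. *)
Lemma lebesgue_measure_affine (c b : R) (A : set RR) : c != 0 -> measurable A ->
  (`|c|%:E * mu ((fun x : RR => c * x + b : RR)%R @^-1` A) = mu A)%E.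
Proof.
move=> c0 mA.
pose phi := (fun x : RR => c * x + b : RR).
have mphi : measurable_fun setT phi := measurable_affine c b.
pose nu_ : {measure set RR -> \bar R} :=
  mscale (NngNum (normr_ge0 c)) (pushforward mu phi).
pose nu := nu_ mphi.
rewrite -[LHS]/(nu A); apply/esym/lebesgue_measure_unique => //= _ [[p q]] _ <-.
rewrite /nu /mscale /= /pushforward /=.
have [c_lt0|c_gt0|c_eq0] := ltgtP c 0; last by rewrite c_eq0 eqxx in c0.
  rewrite (_ : phi @^-1` _ = `[(q - b) / c, (p - b) / c[%classic).
    rewrite !lebesgue_measure_itv /= !lte_fin.
    rewrite ltr_ndivrMr // divfK ?lt_eqF // ltrD2r.
    case: ifPn => pq; last by rewrite mule0.
    by rewrite -!EFinD -EFinM (ltr0_norm c_lt0); congr (_%:E); field.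
  apply/seteqP; split => x; rewrite /phi /= !in_itv /= ler_ndivrMr // ltr_ndivlMr //;
    move=> /andP[h1 h2]; apply/andP; split; lra.
rewrite (_ : phi @^-1` _ = `](p - b) / c, (q - b) / c]%classic).
  rewrite !lebesgue_measure_itv /= !lte_fin.
  rewrite ltr_pdivrMr // divfK ?gt_eqF // ltrD2r.
  case: ifPn => pq; last by rewrite mule0.
  by rewrite -!EFinD -EFinM (gtr0_norm c_gt0); congr (_%:E); field.
apply/seteqP; split => x; rewrite /phi /= !in_itv /= ltr_pdivrMr // ler_pdivlMr //;
  move=> /andP[h1 h2]; apply/andP; split; lra.
Qed.

Lemma integral_affine (c b : R) (f : R -> \bar R) : c != 0 ->
  measurable_fun setT (f : RR -> _) -> (forall x, 0 <= f x)%E ->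
  (\int[mu]_x f (c * x + b)%R = `|c|^-1%:E * \int[mu]_x f x)%E.
Proof.
move=> c0 mf f0.
pose phi := (fun x : RR => c * x + b : RR).
have mphi : measurable_fun setT phi := measurable_affine c b.
pose nu_ : {measure set RR -> \bar R} :=
  mscale (NngNum (normr_ge0 c)) (pushforward mu phi).
pose nu := nu_ mphi.
have -> : (\int[mu]_x f x = \int[nu]_x f x)%E.
  apply: eq_measure_integral => A mA _.
  by rewrite /= /nu /mscale /= /pushforward lebesgue_measure_affine.
rewrite ge0_integral_mscale //.
rewrite muleA -EFinM mulVf ?normr_eq0 // mul1e.
by rewrite ge0_integral_pushforward.
Qed.

Lemma integral_monomial (a : R) n : 0 <= a ->
  (\int[mu]_(x in `[0%R, a]) (x ^+ n)%:E = (a ^+ n.+1 / n.+1%:R)%:E)%E.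
Proof.
rewrite le_eqVlt => /orP[/eqP <-|a0].
  by rewrite set_itv1 integral_set1 expr0n mul0r.
have cF : continuous (fun y : R => y ^+ n.+1 * n.+1%:R^-1).
  by move=> x; apply: cvgM; [exact: exprn_continuous|exact: cvg_cst].
rewrite (@continuous_FTC2 _ _ (fun x => x ^+ n.+1 * n.+1%:R^-1)) //.
- by rewrite -EFinB expr0n mul0r subr0.
- by apply: continuous_subspaceT => x; exact: exprn_continuous.
- split.
  + by move=> x _; apply: derivableM => //; exact: exprn_derivable.
  + by apply: cvg_at_right_filter; exact: cF.
  + by apply: cvg_at_left_filter; exact: cF.
- move=> x _; rewrite derive1Mr; last exact: exprn_derivable.
  by rewrite exp_derive1 /GRing.scale /= mulrAC divff ?mul1r // pnatr_eq0.
Qed.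

(** Lets slicing arguments ignore the finitely many heights at which the description of a slice
    breaks down. *)
Lemma integral_eq_off_points (f g : R -> \bar R) (s : seq R) :
  measurable_fun setT (f : RR -> _) -> measurable_fun setT (g : RR -> _) ->
  (forall x, 0 <= f x)%E -> (forall x, 0 <= g x)%E ->
  (forall x, x \notin s -> f x = g x) ->
  (\int[mu]_x f x = \int[mu]_x g x)%E.
Proof.
move=> mf mg f0 g0 fg; apply: ge0_ae_eq_integral => //.
exists [set` s]; split.
- by apply: countable_measurable => //; exact: finite_set_countable (finite_seq s).
- by apply: countable_lebesgue_measure0; exact: finite_set_countable (finite_seq s).
- move=> x /= nfg; apply: contrapT => /negP xs; apply: nfg => _.
  exact: fg.
Qed.

End Lebesgue1.

(** * Volumes of simplices, disjoint unions and pyramids *)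

Section LebesgueTupleSlices.
Local Open Scope classical_set_scope.
Context {R : realType}.
Local Notation RR := (measurableTypeR R).
Local Notation mu := (@lebesgue_measure R).

(** One common factor suffices: slices of a pyramid are homothetic, and the projection of a facet
    only translates its coordinates. *)
Lemma lebesgue_tuple_affine k (c : R) (a : 'I_k -> R) (A : set (k.-tuple R)) :
  0 < c -> measurable_tset A ->
  (lebesgue_tuple [set t : k.-tuple R | A [tuple (c * tnth t i + a i)%R | i < k]] =
   (c^-1 ^+ k)%:E * lebesgue_tuple A)%E.
Proof.
move=> c0; elim: k a A => [|k IH] a A mA.
  rewrite expr0 mul1e; congr lebesgue_tuple; apply/funext => t /=.
  by rewrite [in RHS](tuple0 t) [X in A X]tuple0.
pose h (y : RR) := lebesgue_tuple [set t : k.-tuple R | A [tuple of y :: t]].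
have mh : measurable_fun setT h by exact: measurable_lebesgue_cons.
have h0 y : (0 <= h y)%E by exact: lebesgue_tuple_ge0.
have ck0 : 0 <= c^-1 ^+ k by rewrite exprn_ge0 // invr_ge0 ltW.
rewrite lebesgue_tuple_cons (_ : (c^-1 ^+ k.+1)%:E = (c^-1 ^+ k)%:E * `|c|^-1%:E)%E.
  rewrite -muleA -(integral_affine (a ord0)) ?gt_eqF // -[in RHS]ge0_integralZl //.
  - apply: eq_integral => x _.
    rewrite /h -(IH (fun i => a (lift ord0 i)) _ (measurable_tset_cons _ mA)).
    congr lebesgue_tuple; apply/funext => t /=; congr (A _).
    apply: eq_from_tnth => j; rewrite tnth_mktuple.
    case: (unliftP ord0 j) => [j' ->|->]; first by rewrite !tnthS tnth_mktuple.
    by rewrite !tnth0.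
  - exact: (measurableT_comp mh (measurable_affine c (a ord0))).
  - by move=> x _; exact: h0.
by rewrite -EFinM gtr0_norm // exprSr.
Qed.

Lemma lebesgue_tuple_simplex k (a : R) : 0 <= a ->
  lebesgue_tuple [set t : k.-tuple R |
    (forall i, 0 <= tnth t i) /\ \sum_i tnth t i <= a] = (a ^+ k / k`!%:R)%:E.
Proof.
elim: k a => [|k IH] a a0.
  rewrite /= indicE mem_set ?expr0 ?fact0 ?divr1 //=.
  by split; [case|rewrite big_ord0].
(* The slice at first coordinate [x] is a simplex of size [a - x]; [g] is its volume as a function
   of that size, set to zero outside [[0, a]]. *)
pose g (y : R) : \bar R := ((fun y => (y ^+ k / k`!%:R)%:E) \_ `[0%R, a]) y.
rewrite lebesgue_tuple_cons.
transitivity (\int[mu]_x g (-1 * x + a)%R)%E.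
  apply: eq_integral => x _; rewrite /g patchE mulN1r mem_setE in_itv /=.
  have -> : (0 <= - x + a <= a) = (0 <= x <= a).
    by apply/idP/idP => /andP[]; lra.
  case: ifPn => [/andP[x0 xa]|xa].
    rewrite -IH; last lra.
    congr lebesgue_tuple; apply/seteqP; split => t [ht st]; split.
    - by move=> i; have := ht (lift ord0 i); rewrite tnthS.
    - move: st; rewrite big_ord_recl tnth0.
      under eq_bigr do rewrite tnthS.
      lra.
    - by move=> i; case: (unliftP ord0 i) => [j ->|->]; rewrite ?tnthS ?tnth0.
    - rewrite big_ord_recl tnth0.
      under eq_bigr do rewrite tnthS.
      lra.
  rewrite (_ : mkset _ = set0) ?lebesgue_tuple0 // -subset0 => t /= [ht st].
  move: xa; apply/negP; rewrite negbK.
  have x0 : 0 <= x by have := ht ord0; rewrite tnth0.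
  rewrite x0 /=; apply: le_trans st; rewrite big_ord_recl tnth0 lerDl.
  by apply: sumr_ge0 => i _; exact: ht.
rewrite integral_affine ?oppr_eq0 ?oner_eq0 //.
- rewrite normrN1 invr1 mul1e /g -integral_mkcond.
  under eq_integral do rewrite EFinM muleC.
  rewrite ge0_integralZl //.
  + rewrite integral_monomial // -EFinM factS natrM invfM; congr (_%:E).
    ring.
  + by apply/measurable_EFinP; exact: exprn_measurable.
  + by move=> x; rewrite /= in_itv /= => /andP[x0 _]; rewrite lee_fin exprn_ge0.
- have mg : measurable_fun (`[0%R, a] : set RR) (fun y : RR => (y ^+ k / k`!%:R)%:E).
    by apply/measurable_EFinP; apply: measurable_funM => //; exact: exprn_measurable.
  have := (measurable_restrictT _ (measurable_itv _)).1 mg.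
  by congr measurable_fun; apply/funext => y; rewrite /g.
- move=> y; rewrite /g patchE mem_setE in_itv /=; case: ifPn => // /andP[y0 _].
  by rewrite lee_fin divr_ge0 ?exprn_ge0.
Qed.

Lemma measurable_tset_le k (f g : k.-tuple RR -> RR) :
  measurable_fun setT f -> measurable_fun setT g ->
  measurable_tset [set t : k.-tuple R | f t <= g t].
Proof.
move=> mf mg; have mh := measurable_fun_ler mf mg.
rewrite /measurable_tset -[X in measurable X]setTI.
rewrite (_ : mkset _ = (fun t => f t <= g t) @^-1` [set true]).
  exact: mh.
by apply/seteqP; split => t /=; [move=> ->|move=> ->].
Qed.

Lemma measurable_tset_lt k (f g : k.-tuple RR -> RR) :
  measurable_fun setT f -> measurable_fun setT g ->
  measurable_tset [set t : k.-tuple R | f t < g t].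
Proof.
move=> mf mg; rewrite (_ : mkset _ = ~` [set t | g t <= f t]).
  by apply: measurableC; exact: measurable_tset_le.
by apply/seteqP; split => t /=; [rewrite ltNge => /negP|move/negP; rewrite -ltNge].
Qed.

Lemma measurable_tset_forall k (I : finType) (P : I -> k.-tuple R -> Prop) :
  (forall i, measurable_tset (P i)) ->
  measurable_tset [set t | forall i, P i t].
Proof.
move=> mP; rewrite (_ : mkset _ = \bigcap_(i in [set: I]) P i).
  by apply: fin_bigcap_measurable => // i _; exact: mP.
by apply/seteqP; split => t //= h i; [move=> _|]; exact: h.
Qed.

Lemma measurable_tset_exists k (I : finType) (P : I -> k.-tuple R -> Prop) :
  (forall i, measurable_tset (P i)) ->
  measurable_tset [set t | exists i, P i t].
Proof.
move=> mP; rewrite (_ : mkset _ = \bigcup_(i in [set: I]) P i).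
  by apply: fin_bigcup_measurable => // i _; exact: mP.
by apply/seteqP; split => t /= [i]; [exists i|move=> _; exists i].
Qed.

Lemma measurable_tset_and k (P Q : k.-tuple R -> Prop) :
  measurable_tset P -> measurable_tset Q ->
  measurable_tset [set t | P t /\ Q t].
Proof. exact: measurableI. Qed.

Lemma measurable_linear_tuple k (c : 'I_k -> R) :
  measurable_fun setT (fun t : k.-tuple RR => \sum_j c j * tnth t j : RR).
Proof.
apply: measurable_sum => j; apply: measurable_funM => //.
exact: measurable_tnth.
Qed.

Lemma lebesgue_tuple_exists k (I : finType) (Q : I -> set (k.-tuple R)) :
  (forall i, measurable_tset (Q i)) ->
  (forall i j t, Q i t -> Q j t -> i = j) ->
  lebesgue_tuple [set t | exists i, Q i t] = (\sum_i lebesgue_tuple (Q i))%E.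
Proof.
move=> mQ dQ.
suff H (s : seq I) : uniq s -> measurable_tset [set t | exists2 i, i \in s & Q i t] /\
    lebesgue_tuple [set t | exists2 i, i \in s & Q i t] =
    (\sum_(i <- s) lebesgue_tuple (Q i))%E.
  rewrite (_ : mkset _ = [set t | exists2 i, i \in index_enum I & Q i t]).
    by have [_ ->] := H _ (index_enum_uniq I).
  by apply/seteqP; split => t [i Qi]; exists i; rewrite ?mem_index_enum.
elim: s => [_|i s IH /=].
  rewrite big_nil (_ : mkset _ = set0) ?lebesgue_tuple0; last first.
    by rewrite -subset0 => t /= [].
  by split=> [|//]; exact: (@measurable0 _ (k.-tuple RR)).
move=> /andP[iNs /IH[mS LS]].
rewrite (_ : mkset _ = Q i `|` [set t | exists2 i, i \in s & Q i t]).
  split; first by apply: (@measurableU _ (k.-tuple RR)) => //; exact: mQ.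
  rewrite big_cons -LS lebesgue_tuple_setU //.
  rewrite -subset0 => t [Qit [j js Qjt]].
  by move: iNs; rewrite (dQ _ _ _ Qit Qjt) js.
apply/seteqP; split => t /=.
  by move=> [j]; rewrite inE => /orP[/eqP -> |]; [left|right; exists j].
by move=> [|[j js]]; [exists i; rewrite ?mem_head|exists j; rewrite // inE js orbT].
Qed.

Lemma lebesgue_tuple_null k (A : set (k.+1.-tuple R)) (i : 'I_k.+1) (a : R) :
  measurable_tset A -> (forall t, A t -> tnth t i = a) ->
  lebesgue_tuple A = 0%E.
Proof.
move=> mA Aa; rewrite (lebesgue_tuple_insert i) //.
rewrite (@integral_eq_off_points _ _ (cst 0%E) [:: a]) ?integral0 //.
- exact: measurable_lebesgue_insert.
- by move=> x; exact: lebesgue_tuple_ge0.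
- move=> x; rewrite inE => /eqP xa.
  rewrite (_ : mkset _ = set0) ?lebesgue_tuple0 // -subset0 => t /= /Aa.
  by rewrite tnth_insert.
Qed.

(* Slicing orthogonally to the [i]-th coordinate, a pyramid over the base [F]
   placed at height [a] has homothetic slices. *)
Lemma lebesgue_tuple_pyramid k (i : 'I_k.+1) (a c : R)
    (A : set (k.+1.-tuple R)) (F : set (k.-tuple R)) :
  0 < a -> measurable_tset A -> measurable_tset F -> lebesgue_tuple F = c%:E ->
  (forall s t, 0 < s -> s < a ->
     A (insert_tuple i s t) <-> F [tuple a / s * tnth t j | j < k]) ->
  (forall t, A t -> 0 < tnth t i <= a) ->
  lebesgue_tuple A = (a * c / k.+1%:R)%:E.
Proof.
move=> a0 mA mF LF AF Ai.
have c0 : 0 <= c by rewrite -lee_fin -LF lebesgue_tuple_ge0.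
(* The slice at height [y] is the base scaled by [y / a], which multiplies its measure by the [k]-th
   power of that ratio. *)
pose g (y : R) : \bar R := ((fun y => (c / a ^+ k * y ^+ k)%:E) \_ `[0%R, a]) y.
have mg : measurable_fun (`[0%R, a] : set RR) (fun y : RR => (c / a ^+ k * y ^+ k)%:E).
  by apply/measurable_EFinP; apply: measurable_funM => //; exact: exprn_measurable.
rewrite (lebesgue_tuple_insert i) //.
rewrite (@integral_eq_off_points _ _ g [:: 0; a]); first last.
- move=> s; rewrite !inE negb_or => /andP[s0 sa].
  rewrite /g patchE mem_setE in_itv /= !le_eqVlt eq_sym (negbTE s0) (negbTE sa) /=.
  case: ifPn => [/andP[s_gt0 s_lta]|/negP sout].
    rewrite (_ : mkset _ = [set t : k.-tuple R | F [tuple a / s * tnth t j + 0 | j < k]]).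
      rewrite lebesgue_tuple_affine ?divr_gt0 // LF -EFinM; congr (_%:E).
      rewrite invf_div expr_div_n; field.
      by rewrite expf_neq0 // gt_eqF.
    apply/seteqP; split => t /=.
      move=> /AF -/(_ s_gt0 s_lta); congr F.
      by apply: eq_from_tnth => j; rewrite !tnth_mktuple addr0.
    move=> h; apply/AF => //; move: h; congr F.
    by apply: eq_from_tnth => j; rewrite !tnth_mktuple addr0.
  rewrite (_ : mkset _ = set0) ?lebesgue_tuple0 // -subset0 => t /= /Ai.
  by rewrite tnth_insert le_eqVlt (negbTE sa).
- move=> y; rewrite /g patchE mem_setE in_itv /=; case: ifPn => // /andP[y0 _].
  by rewrite lee_fin mulr_ge0 ?divr_ge0 ?exprn_ge0 // ltW.
- by move=> x; exact: lebesgue_tuple_ge0.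
- have := (measurable_restrictT _ (measurable_itv _)).1 mg.
  by congr measurable_fun; apply/funext => y; rewrite /g.
- exact: measurable_lebesgue_insert.
rewrite /g -integral_mkcond.
under eq_integral do rewrite EFinM.
rewrite ge0_integralZl //.
- rewrite integral_monomial ?ltW // -EFinM exprS; congr (_%:E); field.
  by rewrite expf_neq0 ?gt_eqF //= -natr1 natr1 pnatr_eq0.
- by apply/measurable_EFinP; exact: exprn_measurable.
- by move=> x; rewrite /= in_itv /= => /andP[x0 _]; rewrite lee_fin exprn_ge0.
- by rewrite lee_fin divr_ge0 // exprn_ge0 // ltW.
Qed.

End LebesgueTupleSlices.

(** * Normal polytopes of simplicial cones *)

Section InnerProduct.
Context {R : realType} {N : vectType R}.
Variable ip : {dot N for @idfun R}.

Lemma ipC u v : ip u v = ip v u.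
Proof. by rewrite (@hermC _ _ (@idfun R : {rmorphism R -> R}) _ ip) expr0 mul1r. Qed.

Lemma ipDr u v w : ip u (v + w) = ip u v + ip u w.
Proof. exact: linearDr. Qed.
Lemma ipBr u v w : ip u (v - w) = ip u v - ip u w.
Proof. exact: linearBr. Qed.
Lemma ipZr a u v : ip u (a *: v) = a * ip u v.
Proof. exact: linearZr_LR. Qed.
Lemma ip0r u : ip u 0 = 0.
Proof. exact: linear0r. Qed.
Lemma ip_sumr (I : Type) (r : seq I) (P : pred I) (F : I -> N) u :
  ip u (\sum_(i <- r | P i) F i) = \sum_(i <- r | P i) ip u (F i).
Proof. by elim/big_rec2: _ => [|i a b _ <-]; rewrite ?ip0r ?ipDr. Qed.

Lemma ipDl u v w : ip (v + w) u = ip v u + ip w u.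
Proof. by rewrite ipC ipDr !(ipC u). Qed.
Lemma ipBl u v w : ip (v - w) u = ip v u - ip w u.
Proof. by rewrite ipC ipBr !(ipC u). Qed.
Lemma ipZl a u v : ip (a *: v) u = a * ip v u.
Proof. by rewrite ipC ipZr ipC. Qed.
Lemma ip0l u : ip 0 u = 0.
Proof. by rewrite ipC ip0r. Qed.
Lemma ip_suml (I : Type) (r : seq I) (P : pred I) (F : I -> N) u :
  ip (\sum_(i <- r | P i) F i) u = \sum_(i <- r | P i) ip (F i) u.
Proof. by rewrite ipC ip_sumr; apply: eq_bigr => i _; rewrite ipC. Qed.

Lemma ip_gt0 u : u != 0 -> 0 < ip u u.
Proof. exact: neq0_dnorm_gt0. Qed.
Lemma ip_ge0 u : 0 <= ip u u.
Proof. by have [->|/ip_gt0/ltW//] := eqVneq u 0; rewrite ip0r. Qed.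
Lemma ip_eq0 u : ip u u = 0 -> u = 0.
Proof. by move=> u0; apply/eqP; apply: contraT => /ip_gt0; rewrite u0 ltxx. Qed.

End InnerProduct.

Section SimplicialCone.
Context {R : realType} {N : vectType R}.
Variable ip : {dot N for @idfun R}.

Definition convex (S : set N) : Prop := forall t x y,
  0 <= t -> t <= 1 -> S x -> S y -> S (t *: x + (1 - t) *: y).

Definition pcone d (u : 'I_d -> N) : set N :=
  [set v | exists2 c : 'I_d -> R, forall i, 0 <= c i & v = \sum_i c i *: u i]%classic.

Definition lin_indep d (u : 'I_d -> N) : Prop :=
  forall c : 'I_d -> R, \sum_i c i *: u i = 0 -> forall i, c i = 0.

Definition normal_poly d (u : 'I_d -> N) (z : 'I_d -> R) : set N :=
  [set v | pcone u v /\ forall j, ip v (u j) <= z j]%classic.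

(** Pseudocubicality read off a single cone, with the normal points of its faces as data. In this
    form it passes to projected rays, which need not belong to any fan. *)
Definition vertices d (u : 'I_d -> N) (z : 'I_d -> R) (w : {set 'I_d} -> N) :=
  forall tau : {set 'I_d},
    (exists c : 'I_d -> R, [/\ forall i, 0 <= c i,
       forall i, i \notin tau -> c i = 0 & w tau = \sum_i c i *: u i]) /\
    (forall j, j \in tau -> ip (w tau) (u j) = z j).

Definition proj (e v : N) : N := v - (ip v e / ip e e) *: e.

Lemma projD e v w : proj e (v + w) = proj e v + proj e w.
Proof. by rewrite /proj ipDl mulrDl scalerDl opprD addrACA. Qed.

Lemma projZ e a v : proj e (a *: v) = a *: proj e v.
Proof. by rewrite /proj ipZl scalerBr scalerA mulrA. Qed.

Lemma proj_sum e (I : Type) (r : seq I) (P : pred I) (F : I -> N) :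
  proj e (\sum_(i <- r | P i) F i) = \sum_(i <- r | P i) proj e (F i).
Proof.
elim/big_rec2: _ => [|i a b _ <-]; last by rewrite projD.
by rewrite /proj ip0l mul0r scale0r subr0.
Qed.

Lemma projK e v : proj e v + (ip v e / ip e e) *: e = v.
Proof. exact: subrK. Qed.

Lemma proj_id e : e != 0 -> proj e e = 0.
Proof. by move=> /(ip_gt0 ip) e0; rewrite /proj divff ?gt_eqF // scale1r subrr. Qed.

Lemma ip_proj_l e v : e != 0 -> ip (proj e v) e = 0.
Proof.
by move=> /(ip_gt0 ip) e0; rewrite /proj ipBl ipZl divfK ?gt_eqF // subrr.
Qed.

Lemma ip_projr e v x : e != 0 ->
  ip (proj e v) (proj e x) = ip v x - ip v e * ip e x / ip e e.
Proof.
move=> e0; rewrite {2}/proj ipBr ipZr ip_proj_l // mulr0 subr0.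
by rewrite /proj ipBl ipZl mulrAC.
Qed.

Section Drop.
Context {d : nat}.
Implicit Types (u : 'I_d.+1 -> N) (z : 'I_d.+1 -> R) (i : 'I_d.+1).

Definition drop_ray i u : 'I_d -> N := fun j => proj (u i) (u (lift i j)).

(** By [ip_projr], on the facet [ip v (u i) = z i] pairing the projections of [v] and [u j]
    subtracts exactly this correction from [ip v (u j)], so the bounds correspond. *)
Definition drop_val i u z : 'I_d -> R :=
  fun j => z (lift i j) - z i * ip (u i) (u (lift i j)) / ip (u i) (u i).

Definition drop_vertex i u (w : {set 'I_d.+1} -> N) : {set 'I_d} -> N :=
  fun tau => proj (u i) (w (i |: [set lift i j | j in tau])).

(** The faces of facet [i] are indexed by the sets containing [i]. Projection kills the coefficient
    of [u i] in their vertices and keeps the other coefficients, hence their signs. *)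
Lemma vertices_drop i u z w : u i != 0 -> vertices u z w ->
  vertices (drop_ray i u) (drop_val i u z) (drop_vertex i u w).
Proof.
move=> ui0 uzw tau; set sigma := i |: [set lift i j | j in tau].
have [[c [c0 cN wE]] wz] := uzw sigma.
have lift_sigma j : (lift i j \in sigma) = (j \in tau).
  rewrite inE finset.in_set1 eq_sym (negbTE (neq_lift i j)) /=.
  by rewrite mem_imset //; exact: lift_inj.
split.
  exists (fun j => c (lift i j)); split => // [j jN|].
    by apply: cN; rewrite lift_sigma.
  rewrite /drop_vertex -/sigma wE proj_sum (bigD1_ord i) //= projZ proj_id //.
  by rewrite scaler0 add0r; apply: eq_bigr => j _; rewrite projZ.
move=> j jt; rewrite /drop_vertex /drop_ray -/sigma ip_projr // !wz ?lift_sigma //.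
by rewrite inE finset.in_set1 eqxx.
Qed.

Lemma pcone_drop i u v : u i != 0 -> pcone u v -> pcone (drop_ray i u) (proj (u i) v).
Proof.
move=> ui0 [c c0 ->]; exists (fun j => c (lift i j)) => //.
rewrite proj_sum (bigD1_ord i) //= projZ proj_id // scaler0 add0r.
by apply: eq_bigr => j _; rewrite projZ.
Qed.

Lemma lin_indep_neq0 u i : lin_indep u -> u i != 0.
Proof.
move=> ind; apply/eqP => ui0.
have := ind (fun j => (j == i)%:R); rewrite (bigD1 i) //= ui0 scaler0 add0r.
rewrite big1 => [/(_ erefl i)/eqP|j /negbTE ->]; last by rewrite scale0r.
by rewrite eqxx oner_eq0.
Qed.

Lemma lin_indep_drop i u : lin_indep u -> lin_indep (drop_ray i u).
Proof.
move=> ind c c0 j.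
(* The [u i] components removed by the projections add up to [a]; giving [u i] the coefficient [- a]
   turns a relation among the projections into one among the original vectors. *)
pose a := \sum_j c j * (ip (u (lift i j)) (u i) / ip (u i) (u i)).
pose c' k := if unlift i k is Some j then c j else - a.
have := ind c' _ (lift i j); rewrite /c' liftK; apply.
rewrite (bigD1_ord i) //= unlift_none.
under eq_bigr do rewrite liftK.
rewrite -[RHS]c0 addrC scaleNr /a scaler_suml -sumrB.
by apply: eq_bigr => k _; rewrite -scalerA -scalerBr.
Qed.

Lemma normal_poly_drop i u z f : u i != 0 -> normal_poly u z f -> ip f (u i) = z i ->
  normal_poly (drop_ray i u) (drop_val i u z) (proj (u i) f).
Proof.
move=> ui0 [fC fz] fi; split; first exact: pcone_drop.
by move=> j; rewrite /drop_ray ip_projr // fi lerD2r.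
Qed.

End Drop.

(** The vertex of [[set j]] is a nonnegative multiple of [u j], and its product with [u j] is
    [z j]. *)
Lemma vertices_val_ge0 d (u : 'I_d -> N) z w j : vertices u z w -> 0 <= z j.
Proof.
move=> uzw; have [[c [c0 cN wE]] wz] := uzw [set j].
rewrite -wz ?inE // wE (bigD1 j) //= big1 ?addr0 => [|k kj].
  by rewrite ipZl mulr_ge0 ?ip_ge0.
by rewrite cN ?scale0r // inE.
Qed.

Lemma vertex0 d (u : 'I_d -> N) z w : vertices u z w -> w finset.set0 = 0.
Proof.
move=> uzw; have [[c [c0 cN ->]] _] := uzw finset.set0.
by rewrite big1 // => i _; rewrite cN ?inE // scale0r.
Qed.

(* For [j] outside [tau], the difference between the vertices of [tau + j] and
   of [tau] is orthogonal to [tau], which compares [z j] with the value of the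
   vertex of [tau] on [u j]. *)
Lemma vertices_normal_poly d (u : 'I_d -> N) z w tau :
  vertices u z w -> normal_poly u z (w tau).
Proof.
move=> uzw; have [[c [c0 cN wE]] wz] := uzw tau; split; first by exists c.
move=> j; have [/wz -> //|jN] := boolP (j \in tau).
have [[c' [c'0 c'N w'E]] w'z] := uzw (j |: tau).
set x := w (j |: tau) in w'E w'z *.
have xu k : k \in tau -> ip (x - w tau) (u k) = 0.
  by move=> kt; rewrite ipBl wz // w'z ?subrr // inE kt orbT.
have norm_x : ip (x - w tau) (x - w tau) = c' j * (z j - ip (w tau) (u j)).
  rewrite {2}w'E {2}wE -sumrB (bigD1 j) //= ipDr ip_sumr big1 ?addr0.
    rewrite (cN j) // scale0r subr0 ipZr ipBl w'z //.
    by rewrite inE finset.in_set1 eqxx.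
  move=> k kj; have [kt|kN] := boolP (k \in tau).
    by rewrite -scalerBl ipZr xu // mulr0.
  by rewrite c'N ?cN ?scale0r ?subr0 ?ip0r // inE finset.in_set1 (negbTE kj).
have [c'j|c'j] := eqVneq (c' j) 0.
  have /(ip_eq0 (ip := ip)) /eqP : ip (x - w tau) (x - w tau) = 0.
    by rewrite norm_x c'j mul0r.
  by rewrite subr_eq0 => /eqP <-; rewrite w'z // inE finset.in_set1 eqxx.
have := ip_ge0 ip (x - w tau); rewrite norm_x pmulr_rge0 ?subr_ge0 //.
by rewrite lt_neqAle eq_sym c'j c'0.
Qed.

Lemma convex_normal_poly d (u : 'I_d -> N) z : convex (normal_poly u z).
Proof.
move=> t x y t0 t1 [[a a0 ->] ax] [[b b0 ->] bx].
have t1' : 0 <= 1 - t by rewrite subr_ge0.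
split.
  exists (fun i => t * a i + (1 - t) * b i).
    by move=> i; rewrite addr_ge0 // mulr_ge0.
  rewrite !scaler_sumr -big_split; apply: eq_bigr => i _.
  by rewrite /= !scalerA -scalerDl.
move=> j; rewrite ipDl !ipZl.
have -> : z j = t * z j + (1 - t) * z j by ring.
by rewrite lerD // ler_wpM2l.
Qed.

(* The ray from the origin through a point leaves the polytope through the
   facet on which [ip v (u j) / z j] is largest; project it along [u i]. *)
Lemma normal_poly_sub_hull d (u : 'I_d -> N) z w (S : set N) :
  vertices u z w -> convex S -> (forall tau, S (w tau)) -> (normal_poly u z `<=` S)%classic.
Proof.
elim: d u z w S => [|d IH] u z w S uzw cS Sw v [vC vz].
  have -> : v = w finset.set0 by case: vC => c _ ->; rewrite (vertex0 uzw) big_ord0.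
  exact: Sw.
have [->|v0] := eqVneq v 0; first by rewrite -(vertex0 uzw); exact: Sw.
(* Since [v] is a nonnegative combination of the [u i], the inequality [ip v v > 0] requires some
   positive [ip v (u i)]. *)
have [i0 vi0] : exists i, 0 < ip v (u i).
  apply: contrapT => /forallNP vN.
  have := ip_gt0 ip v0; rewrite ltNge => /negP; apply.
  have [c c0 {2}->] := vC; rewrite ip_sumr sumr_le0 // => i _.
  by rewrite ipZr mulr_ge0_le0 // leNgt; apply/negP.
have z_gt0 j : 0 < ip v (u j) -> 0 < z j by move=> vj; apply: lt_le_trans (vz j).
pose i := [arg max_(i > i0 | 0 < ip v (u i)) (ip v (u i) / z i)]%O.
have [vi imax] : 0 < ip v (u i) /\
    forall j, 0 < ip v (u j) -> ip v (u j) / z j <= ip v (u i) / z i.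
  by rewrite /i; case: arg_maxP.
have zi := z_gt0 _ vi.
have ui0 : u i != 0 by apply: contraTneq vi => ->; rewrite ip0r ltxx.
set m := ip v (u i) / z i in imax.
have m0 : 0 < m by rewrite divr_gt0.
have m1 : m <= 1 by rewrite ler_pdivrMr // mul1r.
(* The exit point of the ray through [v]; as [m <= 1], [v] lies between it and the origin, which is
   the vertex of the empty set. *)
pose f := m^-1 *: v.
have vf : v = m *: f + (1 - m) *: w finset.set0.
  by rewrite (vertex0 uzw) scaler0 addr0 scalerA divff ?scale1r // gt_eqF.
have fi : ip f (u i) = z i.
  by rewrite ipZl /m invf_div mulfVK // gt_eqF.
have fP : normal_poly u z f.
  split.
    have [c c0 vE] := vC; exists (fun i => m^-1 * c i).
      by move=> j; rewrite mulr_ge0 // invr_ge0 ltW.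
    by rewrite /f vE scaler_sumr; apply: eq_bigr => j _; rewrite scalerA.
  move=> j; rewrite ipZl; have [vj|vj] := ltP 0 (ip v (u j)).
    have := imax _ vj; rewrite ler_pdivrMr ?z_gt0 // => h.
    by rewrite mulrC ler_pdivrMr // mulrC.
  apply: (@le_trans _ _ 0); last exact: vertices_val_ge0 uzw.
  by rewrite mulr_ge0_le0 // invr_ge0 ltW.
rewrite vf; apply: (cS) => //; first exact: ltW.
(* All points of the facet have the same component along [u i], so adding it back undoes the
   projection. That [S] is any convex set, not a fixed hull, permits this translation. *)
pose S' := [set x | S (x + (z i / ip (u i) (u i)) *: u i)]%classic.
suff : S' (proj (u i) f) by rewrite /S' /= -fi projK.
apply: (IH _ _ _ S' (vertices_drop ui0 uzw) _ _ _ (normal_poly_drop ui0 fP fi)).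
- move=> t x y t0 t1 /= Sx Sy.
  have := cS _ _ _ t0 t1 Sx Sy; congr S.
  rewrite !scalerDr addrACA -!scalerA -scalerDl; congr (_ + _).
  by rewrite addrC subrK scale1r.
- move=> tau; rewrite /S' /= /drop_vertex; set sigma := i |: _.
  have [_ wz] := uzw sigma.
  by rewrite -(wz i) ?projK; [exact: Sw|rewrite inE finset.in_set1 eqxx].
Qed.

(** A converse to [normal_poly_drop]. That the lifted point lies in the cone is not automatic: it
    holds at the projected vertices, which lift to vertices, and convexity extends it. *)
Lemma normal_poly_lift d (u : 'I_d.+1 -> N) z w i x : u i != 0 -> vertices u z w ->
  normal_poly (drop_ray i u) (drop_val i u z) x ->
  normal_poly u z (x + (z i / ip (u i) (u i)) *: u i).
Proof.
move=> ui0 uzw.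
apply: (@normal_poly_sub_hull _ _ _ _
  [set y | normal_poly u z (y + (z i / ip (u i) (u i)) *: u i)]%classic).
- exact: vertices_drop ui0 uzw.
- move=> t a b t0 t1 /= Sx Sy.
  have := convex_normal_poly t0 t1 Sx Sy; congr (normal_poly _ _ _).
  rewrite !scalerDr addrACA -!scalerA -scalerDl; congr (_ + _).
  by rewrite addrC subrK scale1r.
- move=> tau /=; rewrite /drop_vertex; set sigma := i |: _.
  have [_ wz] := uzw sigma.
  rewrite -(wz i) ?projK; last by rewrite inE finset.in_set1 eqxx.
  exact: vertices_normal_poly uzw.
Qed.

End SimplicialCone.

(** * Volume of a normal polytope by pyramids over its facets *)

Section Volume.
Context {R : realType} {N : vectType R}.
Variable ip : {dot N for @idfun R}.
Local Notation RR := (measurableTypeR R).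

(** [M] is the inverse Gram matrix: a combination orthogonal to all [u j] has norm zero, so
    independence makes the matrix invertible. It expresses the cone condition by linear inequalities
    in the coordinates [ip v (u j)]. *)
Lemma gram_solve d (u : 'I_d -> N) : lin_indep u ->
  exists M : 'I_d -> 'I_d -> R, forall t c : 'I_d -> R,
    (forall j, ip (\sum_k c k *: u k) (u j) = t j) <->
    (forall k, c k = \sum_j M k j * t j).
Proof.
move=> ind; pose G := \matrix_(k, j) ip (u k) (u j).
have rG (c : 'I_d -> R) j : ((\row_k c k) *m G) 0 j = ip (\sum_k c k *: u k) (u j).
  by rewrite mxE ip_suml; apply: eq_bigr => k _; rewrite !mxE ipZl.
have Gunit : G \in unitmx.
  rewrite -row_free_unit; apply: inj_row_free => v vG0.
  have vE : v = \row_k v 0 k by apply/rowP => k; rewrite mxE.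
  have v0 : \sum_k v 0 k *: u k = 0.
    apply: (ip_eq0 (ip := ip)); rewrite ip_sumr big1 // => j _.
    by rewrite ipZr -rG -vE vG0 mxE mulr0.
  by apply/rowP => k; rewrite mxE; exact: ind v0 k.
exists (fun k j => invmx G j k) => t c; split.
  move=> ct k.
  have : (\row_j t j) *m invmx G = \row_k c k.
    rewrite (_ : \row_j t j = (\row_k c k) *m G) ?mulmxK //.
    by apply/rowP => j; rewrite rG mxE ct.
  move=> /rowP/(_ k); rewrite !mxE => <-.
  by apply: eq_bigr => j _; rewrite mxE mulrC.
move=> cM j; rewrite -rG.
rewrite (_ : \row_k c k = (\row_j t j) *m invmx G) ?mulmxKV ?mxE //.
by apply/rowP => k; rewrite !mxE cM; apply: eq_bigr => l _; rewrite mxE mulrC.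
Qed.

(* [normal_poly u z] in the coordinates [ip v (u j)].  The facets in [J] are
   removed so that pyramids can be made disjoint, not just almost disjoint. *)
Definition tpoly d (J : pred 'I_d) (u : 'I_d -> N) (z : 'I_d -> R) :
    set (d.-tuple R) :=
  [set t | (exists2 v, pcone u v & forall j, ip v (u j) = tnth t j) /\
     forall j, if J j then tnth t j < z j else tnth t j <= z j]%classic.

Lemma measurable_tpoly d (J : pred 'I_d) (u : 'I_d -> N) z :
  lin_indep u -> measurable_tset (tpoly J u z).
Proof.
move=> ind; have [M MP] := gram_solve ind.
rewrite (_ : tpoly J u z = [set t | (forall k, 0 <= \sum_j M k j * tnth t j) /\
   forall j, if J j then tnth t j < z j else tnth t j <= z j]%classic).
  apply: measurable_tset_and; apply: measurable_tset_forall => j.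
    apply: (@measurable_tset_le _ _ (cst 0)) => //.
    exact: measurable_linear_tuple.
  case: (J j).
    by apply: (@measurable_tset_lt _ _ _ (cst (z j))) => //; exact: measurable_tnth.
  by apply: (@measurable_tset_le _ _ _ (cst (z j))) => //; exact: measurable_tnth.
apply/seteqP; split => t /= [tC tz]; split => //.
  case: tC => v [c c0 ->] /MP cE k.
  by rewrite -cE.
exists (\sum_k (\sum_j M k j * tnth t j) *: u k); last exact/MP.
by exists (fun k => \sum_j M k j * tnth t j).
Qed.

(** For values with vertices this is [d!] times the Lebesgue measure of [tpoly]; the factor absorbs
    the division by the dimension in each pyramid volume. *)
Fixpoint vol_poly d : ('I_d -> N) -> ('I_d -> R) -> R :=
  match d with
  | 0 => fun _ _ => 1
  | d'.+1 => fun u z =>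
      \sum_i z i * vol_poly (drop_ray ip i u) (drop_val ip i u z)
  end.

Section Slices.
Context {d : nat}.
Variables (u : 'I_d.+1 -> N) (z : 'I_d.+1 -> R).
Variable w : {set 'I_d.+1} -> N.
Hypothesis uzw : vertices ip u z w.
Hypothesis ind : lin_indep u.

(** The projection subtracts a constant from each coordinate of the facet; [normal_poly_lift] gives
    the way back. The factor [1] fits the shape of [lebesgue_tuple_affine]. *)
Lemma tpoly_facet (J : pred 'I_d.+1) i (t : d.-tuple R) : ~~ J i ->
  tpoly J u z (insert_tuple i (z i) t) <->
  tpoly (J \o lift i) (drop_ray ip i u) (drop_val ip i u z)
    [tuple 1 * tnth t j - z i * ip (u i) (u (lift i j)) / ip (u i) (u i) | j < d].
Proof.
move=> Ji; have ui0 := lin_indep_neq0 i ind.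
have uu0 : ip (u i) (u i) != 0 by rewrite gt_eqF // ip_gt0.
have H2 : (forall j, if J j then tnth (insert_tuple i (z i) t) j < z j
                     else tnth (insert_tuple i (z i) t) j <= z j) <->
  (forall j, if J (lift i j) then tnth t j < z (lift i j)
                     else tnth t j <= z (lift i j)).
  split=> h j; first by have := h (lift i j); rewrite tnth_insert_lift.
  case: (unliftP i j) => [j' ->|->]; first by rewrite tnth_insert_lift.
  by rewrite tnth_insert (negbTE Ji).
split=> [[[v vC vt] vz]|[[v vC vt] vz]].
  split; first exists (proj ip (u i) v).
  - exact: pcone_drop.
  - move=> j; rewrite tnth_mktuple ip_projr // mul1r !vt.
    by rewrite tnth_insert tnth_insert_lift.
  - move=> j; have := H2.1 vz j; rewrite /= tnth_mktuple mul1r /drop_val.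
    by case: (J _); rewrite ?ltrD2r ?lerD2r.
have vz' j : if J (lift i j) then tnth t j < z (lift i j)
                     else tnth t j <= z (lift i j).
  have := vz j; rewrite /= tnth_mktuple mul1r /drop_val.
  by case: (J _); rewrite ?ltrD2r ?lerD2r.
split; last exact/H2.
exists (v + (z i / ip (u i) (u i)) *: u i).
  have vP : normal_poly ip (drop_ray ip i u) (drop_val ip i u z) v.
    split => // j; have := vz j; rewrite /= -vt.
    by case: (J _) => // /ltW.
  by have [] := normal_poly_lift ui0 uzw vP.
have vu : ip v (u i) = 0.
  have [c _ ->] := vC; rewrite ip_suml big1 // => j _.
  by rewrite ipZl ip_proj_l // mulr0.
move=> j; rewrite ipDl ipZl; case: (unliftP i j) => [j' ->|->].
  rewrite tnth_insert_lift; have := vt j'; rewrite tnth_mktuple mul1r.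
  rewrite /drop_ray /proj ipBr ipZr vu mulr0 subr0 => ->.
  by rewrite mulrAC subrK.
by rewrite tnth_insert vu add0r divfK.
Qed.

(* The pyramid with apex the origin over the [i]-th facet: ties between the
   ratios [tnth t j / z j] go to the smallest index. *)
Definition pyramid (J : pred 'I_d.+1) i : set (d.+1.-tuple R) :=
  [set t | [/\ tpoly J u z t, 0 < tnth t i & forall j, 0 < z j ->
     if (j < i)%N then tnth t j * z i < tnth t i * z j
     else tnth t j * z i <= tnth t i * z j]]%classic.

(** At the base height [z i] the tie rule makes the facets of smaller index strict. Where [z j] is
    zero there is no ratio to compare, and the strictness prescribed by [J] persists. *)
Definition base_strict (J : pred 'I_d.+1) i : pred 'I_d.+1 :=
  fun j => if 0 < z j then (j < i)%N else J j.

Lemma measurable_pyramid J i : measurable_tset (pyramid J i).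
Proof.
have mt j : measurable_fun setT (fun t : d.+1.-tuple RR => tnth t j : RR).
  exact: measurable_tnth.
rewrite (_ : pyramid J i = [set t | tpoly J u z t /\ (0 < tnth t i /\
   forall j, 0 < z j ->
     if (j < i)%N then tnth t j * z i < tnth t i * z j
     else tnth t j * z i <= tnth t i * z j)]%classic).
  apply: measurable_tset_and; first exact: measurable_tpoly.
  apply: measurable_tset_and.
    by apply: (@measurable_tset_lt _ _ (cst 0)) => //.
  apply: measurable_tset_forall => j.
  have [zj|zj] := boolP (0 < z j); last first.
    rewrite (_ : (fun _ => _) = setT); first exact: (@measurableT _ (d.+1.-tuple RR)).
    by apply/seteqP; split.
  rewrite (_ : (fun _ => _) = [set t | if (j < i)%N then tnth t j * z i < tnth t i * z j
     else tnth t j * z i <= tnth t i * z j]%classic).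
    have mz k (a : R) : measurable_fun setT (fun t : d.+1.-tuple RR => tnth t k * a : RR).
      apply: measurable_funM => //; exact: mt.
    by case: (j < i)%N; [apply: measurable_tset_lt|apply: measurable_tset_le].
  by apply/seteqP; split => t /=; [apply|move=> h _].
by apply/seteqP; split => t [] // a [].
Qed.

Lemma pyramid_inj J i j t : pyramid J i t -> pyramid J j t -> i = j.
Proof.
have zpos k s : pyramid J k s -> 0 < z k.
  move=> [[_ /(_ k) sk] s0 _]; apply: lt_le_trans s0 _.
  by move: sk; case: (J k) => // /ltW.
wlog: i j / (i <= j)%N => [H ti tj|].
  by case: (leqP i j) => [/H->//|/ltnW/H/(_ tj ti)].
rewrite leq_eqVlt => /orP[/eqP/val_inj //|ij ti tj].
have zi := zpos _ _ ti; have zj := zpos _ _ tj.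
case: ti => _ _ /(_ j zj); rewrite ltnNge (ltnW ij) /= => h1.
case: tj => _ _ /(_ i zi); rewrite ij => h2.
by have := lt_le_trans h2 h1; rewrite ltxx.
Qed.

Lemma pyramid_cover J t : tpoly J u z t -> t <> [tuple 0 | i < d.+1] ->
  exists i, pyramid J i t.
Proof.
move=> tP t0; have [[v vC vt] tz] := tP.
have tle j : tnth t j <= z j by have := tz j; case: (J j) => // /ltW.
have v0 : v != 0.
  apply: contra_notN t0 => /eqP v0; apply: eq_from_tnth => j.
  by rewrite -vt v0 ip0l tnth_mktuple.
have [i0 ti0] : exists i, 0 < tnth t i.
  apply: contrapT => /forallNP tN.
  have := ip_gt0 ip v0; rewrite ltNge => /negP; apply.
  have [c c0 {2}->] := vC; rewrite ip_sumr sumr_le0 // => i _.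
  by rewrite ipZr mulr_ge0_le0 // vt leNgt; apply/negP.
have z_gt0 j : 0 < tnth t j -> 0 < z j by move=> tj; apply: lt_le_trans (tle j).
pose m := [arg max_(i > i0 | 0 < tnth t i) (tnth t i / z i)]%O.
have [tm mmax] : 0 < tnth t m /\
    forall j, 0 < tnth t j -> tnth t j / z j <= tnth t m / z m.
  by rewrite /m; case: arg_maxP.
(* [m] attains the largest ratio; the tie rule asks for the least index [i] attaining it. *)
pose P i := (0 < tnth t i) && (tnth t i / z i == tnth t m / z m).
have Pm : P m by rewrite /P tm eqxx.
pose i := [arg min_(i < m | P i) (i : nat)].
have [Pi imin] : P i /\ forall j, P j -> (i <= j)%N.
  by rewrite /i; case: arg_minnP.
have /andP[ti /eqP iE] := Pi.
exists i; split => // j zj; have zi := z_gt0 _ ti.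
have [tj|tj] := ltP 0 (tnth t j); last first.
  have h : tnth t j * z i < tnth t i * z j.
    by apply: (@le_lt_trans _ _ 0); rewrite ?mulr_gt0 // mulr_le0_ge0 // ltW.
  by rewrite h (ltW h); case: ifP.
have := mmax _ tj; rewrite -iE le_eqVlt => /orP[/eqP jE|].
  rewrite ltnNge imin /=; last by rewrite /P tj jE iE eqxx.
  move: jE => /(congr1 (fun x => x * z j * z i)).
  by rewrite divfK ?gt_eqF // mulrAC divfK ?gt_eqF // => ->.
rewrite ltr_pdivrMr // mulrAC ltr_pdivlMr // => h.
by rewrite h (ltW h); case: ifP.
Qed.

(** Scaling by [z i / s] moves the slice to the base, where comparisons of ratios become facet
    inequalities. Below the base the bounds with [z j > 0] hold strictly, whatever [J] says; those
    with [z j = 0] are invariant under scaling. *)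
Lemma pyramid_slice J i s t : 0 < s -> s < z i ->
  pyramid J i (insert_tuple i s t) <->
  tpoly (base_strict J i) u z
    (insert_tuple i (z i) [tuple z i / s * tnth t j | j < d]).
Proof.
move=> s0 sz; have zi := lt_trans s0 sz.
set f := insert_tuple i (z i) _; set g := insert_tuple i s t.
have s'0 : 0 < z i / s by rewrite divr_gt0.
have fg j : tnth f j = z i / s * tnth g j.
  rewrite /f /g; case: (unliftP i j) => [j' ->|->].
    by rewrite !tnth_insert_lift tnth_mktuple.
  by rewrite !tnth_insert divfK // gt_eqF.
have gi : tnth g i = s by rewrite /g tnth_insert.
have fz j : (tnth f j <= z j) = (tnth g j * z i <= s * z j).
  rewrite fg mulrAC ler_pdivrMr // mulrC (mulrC s).
  by [].
have fzlt j : (tnth f j < z j) = (tnth g j * z i < s * z j).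
  rewrite fg mulrAC ltr_pdivrMr // mulrC (mulrC s).
  by [].
have fz0 j : z j = 0 -> (tnth f j <= z j) = (tnth g j <= z j).
  by move=> zj; rewrite fz zj mulr0 pmulr_lle0.
have fzlt0 j : z j = 0 -> (tnth f j < z j) = (tnth g j < z j).
  by move=> zj; rewrite fzlt zj mulr0 pmulr_llt0.
have z_ge0 j : 0 <= z j by exact: vertices_val_ge0 uzw.
have z0 j : (0 < z j) = false -> z j = 0.
  by move=> /negbT; rewrite -leNgt => zj; apply/eqP; rewrite eq_le zj z_ge0.
have scale a b v : 0 < b -> pcone u v -> (forall j, ip v (u j) = tnth a j) ->
    exists2 v, pcone u v & forall j, ip v (u j) = b * tnth a j.
  move=> b0 [c c0 ->] va; exists (b *: \sum_k c k *: u k).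
    exists (fun k => b * c k) => [k|]; first by rewrite mulr_ge0 // ltW.
    by rewrite scaler_sumr; apply: eq_bigr => k _; rewrite scalerA.
  by move=> j; rewrite ipZl va.
split=> [[[[v vC vg] vz] _ vtie]|[[v vC vf] vz]].
  split.
    have [v' v'C v'f] := scale _ _ _ s'0 vC vg.
    by exists v' => // j; rewrite v'f fg.
  move=> j; rewrite /base_strict; case zj : (0 < z j).
    by have := vtie j zj; rewrite gi fz fzlt.
  by rewrite fz0 ?fzlt0; [exact: vz|exact: z0..].
have vz' j : 0 < z j -> tnth g j < z j.
  move=> zj; have fj : tnth f j <= z j.
    by have := vz j; rewrite /base_strict zj; case: (j < i)%N => // /ltW.
  move: fj; rewrite fz -ler_pdivlMr // => /le_lt_trans; apply.
  by rewrite mulrAC gtr_pMl // ltr_pdivrMr // mul1r.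
split=> [||j zj]; last first.
- by have := vz j; rewrite /base_strict zj gi fz fzlt.
- by rewrite gi.
split.
  have [|v' v'C v'g] := scale _ (s / z i) _ _ vC vf; first by rewrite divr_gt0.
  exists v' => // j; rewrite v'g fg mulrA.
  by rewrite mulrA divfK ?gt_eqF // divff ?mul1r // gt_eqF.
move=> j; have [zj|zj] := boolP (0 < z j).
  by have := vz' _ zj; case: (J j) => // /ltW.
have zj0 : z j = 0 by exact/z0/negbTE.
by have := vz j; rewrite /base_strict (negbTE zj) fz0 ?fzlt0.
Qed.

End Slices.

(** The quantification over [J] carries the induction: the bases of the disjoint pyramids lack other
    facets than the polytope does, and the volume must not depend on which. *)
Theorem lebesgue_tpoly d (J : pred 'I_d) (u : 'I_d -> N) z w :
  vertices ip u z w -> lin_indep u ->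
  lebesgue_tuple (tpoly J u z) = (vol_poly u z / d`!%:R)%:E.
Proof.
elim: d J u z w => [|d IH] J u z w uzw ind.
  rewrite /= indicE mem_set ?fact0 ?divr1 //.
  split; last by case.
  by exists 0; [exists (fun=> 0); rewrite ?big_ord0|case].
(* The origin lies in no pyramid; it is split off as a null set. *)
pose O := [set t | tpoly J u z t /\ t = [tuple 0 | i < d.+1]]%classic.
have mO : measurable_tset O.
  apply: measurable_tset_and; first exact: measurable_tpoly.
  rewrite (_ : (fun _ => _) = [set t | forall i, tnth t i <= 0 /\ 0 <= tnth t i]%classic).
    apply: measurable_tset_forall => i; apply: measurable_tset_and.
      by apply: (@measurable_tset_le _ _ _ (cst 0)) => //; exact: measurable_tnth.
    by apply: (@measurable_tset_le _ _ (cst 0)) => //; exact: measurable_tnth.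
  apply/seteqP; split => t /=; first by move=> -> i; rewrite tnth_mktuple lexx.
  move=> h; apply: eq_from_tnth => i; rewrite tnth_mktuple; apply/eqP.
  by rewrite eq_le; have [-> ->] := h i.
pose Q := [set t | exists i, pyramid u z J i t]%classic.
have mQ : measurable_tset Q by apply: measurable_tset_exists => i; exact: measurable_pyramid.
have -> : (tpoly J u z = O `|` Q)%classic.
  apply/seteqP; split => t.
    move=> tP; have [t0|t0] := pselect (t = [tuple 0 | i < d.+1]); first by left.
    by right; exact: pyramid_cover.
  by move=> [[]|[i []]].
rewrite lebesgue_tuple_setU //; last first.
  rewrite -subset0 => t [[_ ->] [i [_]]].
  by rewrite tnth_mktuple ltxx.
rewrite (@lebesgue_tuple_null _ _ O ord0 0) //; last first.
  by move=> t [_ ->]; rewrite tnth_mktuple.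
rewrite add0e lebesgue_tuple_exists; first last.
- by move=> i j t; exact: pyramid_inj.
- by move=> i; exact: measurable_pyramid.
rewrite [vol_poly _ _]/= mulr_suml -sumEFin; apply: eq_bigr => i _.
have := vertices_val_ge0 i uzw; rewrite le_eqVlt => /orP[/eqP zi|zi].
  have -> : pyramid u z J i = classical_sets.set0.
    apply/seteqP; split => // t [[_ /(_ i) tz] ti _].
    have : tnth t i <= z i by move: tz; case: (J i) => // /ltW.
    by rewrite -zi leNgt ti.
  by rewrite lebesgue_tuple0 -zi !mul0r.
have ui0 := lin_indep_neq0 i ind.
have bi : ~~ base_strict z J i i by rewrite /base_strict zi ltnn.
pose F := [set t : d.-tuple R |
  tpoly (base_strict z J i) u z (insert_tuple i (z i) t)]%classic.
have mF : measurable_tset F.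
  by apply: measurable_tset_insert; exact: measurable_tpoly.
have LF : lebesgue_tuple F =
    (vol_poly (drop_ray ip i u) (drop_val ip i u z) / d`!%:R)%:E.
  rewrite -(IH (base_strict z J i \o lift i) _ _ _ (vertices_drop ui0 uzw)); last first.
    exact: lin_indep_drop.
  rewrite -[RHS]mul1e.
  have -> : 1%E = (1^-1 ^+ d : R)%:E by rewrite invr1 expr1n.
  rewrite -(lebesgue_tuple_affine
    (fun j => - (z i * ip (u i) (u (lift i j)) / ip (u i) (u i)))) //; last first.
    by apply: measurable_tpoly; exact: lin_indep_drop.
  by congr lebesgue_tuple; apply/funext => t; apply/propext; exact: tpoly_facet.
rewrite (lebesgue_tuple_pyramid (i := i) zi (measurable_pyramid _ ind _ _) mF LF) //.
- by rewrite factS natrM invfM !mulrA; congr (_%:E); ring.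
- by move=> s t s0 sz; exact: pyramid_slice.
- move=> t [[_ /(_ i) tz] ti _]; rewrite ti /=.
  by move: tz; case: (J i) => // /ltW.
Qed.

End Volume.

(** * Polarization *)

Section Polarization.
Context {R : realFieldType}.

(** The natural numbers below [size p] are already more roots than a nonzero [p] can have. *)
Lemma poly_eq0_nonneg (p : {poly R}) :
  (forall k, 0 <= k -> p.[k] = 0) -> p = 0.
Proof.
move=> p0; apply/eqP; apply: contraT => pN0.
have := @max_poly_roots _ p [seq i%:R | i <- iota 0 (size p)] pN0.
rewrite size_map size_iota ltnn; apply.
  by apply/allP => x /mapP[i _ ->]; rewrite rootE p0.
by rewrite map_inj_uniq ?iota_uniq // => i j /eqP; rewrite eqr_nat => /eqP.
Qed.

Variables (V : eqType) (K : V -> Prop) (comb : R -> V -> V -> V) (d : nat).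
Variable Phi : seq V -> R.
Hypothesis Kcomb : forall k x y, 0 <= k -> K x -> K y -> K (comb k x y).
Hypothesis Phi_perm : forall l l', {in l, forall x, K x} -> size l = d ->
  perm_eq l l' -> Phi l = Phi l'.
Hypothesis Phi_comb : forall k x y l, 0 <= k -> K x -> K y ->
  {in l, forall x, K x} -> (size l).+1 = d ->
  Phi (comb k x y :: l) = Phi (x :: l) + k * Phi (y :: l).
Variable x0 : V.
Hypothesis Kx0 : K x0.
Hypothesis Phi_diag : forall x, K x -> Phi (nseq d x) = 0.

(** The polynomial in [k] obtained by multiplying out [Phi] on [m] copies of [comb k x y] followed
    by [r]. It is built formally because [comb k x y] is controlled only for [k >= 0]. *)
Fixpoint expansion (x y : V) (m : nat) (r : seq V) : {poly R} :=
  if m is m'.+1 then expansion x y m' (x :: r) + 'X * expansion x y m' (y :: r)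
  else (Phi r)%:P.

Lemma in_consK x r : K x -> {in r, forall x, K x} -> {in x :: r, forall x, K x}.
Proof. by move=> Kx Kr z; rewrite inE => /orP[/eqP ->|/Kr]. Qed.

Lemma in_nseqK m x r : K x -> {in r, forall x, K x} ->
  {in nseq m x ++ r, forall x, K x}.
Proof. by move=> Kx Kr; elim: m => //= m IH; exact: in_consK. Qed.

Lemma horner_expansion x y m r k : 0 <= k -> K x -> K y ->
  {in r, forall x, K x} -> (m + size r)%N = d ->
  (expansion x y m r).[k] = Phi (nseq m (comb k x y) ++ r).
Proof.
move=> k0 Kx Ky; have Kc := Kcomb k0 Kx Ky.
elim: m r => [|m IH] r Kr szr /=; first by rewrite hornerC.
rewrite hornerD hornerM hornerX !IH /= ?addnS //; try exact: in_consK.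
have szd : (size (nseq m (comb k x y) ++ r)).+1 = d by rewrite size_cat size_nseq -addSn.
rewrite Phi_comb //; last exact: in_nseqK.
by congr (_ + k * _); apply: Phi_perm; rewrite ?size_cat ?size_nseq /= ?addnS //;
  try (apply: in_nseqK => //; exact: in_consK);
  rewrite -cat1s perm_catCA.
Qed.

Lemma coef0_expansion x y m r : (expansion x y m r)`_0 = Phi (nseq m x ++ r).
Proof.
elim: m r => [|m IH] r /=; first by rewrite coefC.
rewrite coefD coefXM addr0 IH; congr Phi.
by elim: m {IH} => //= m ->.
Qed.

(** The linear terms choose [y] in exactly one of the [m.+1] slots, and symmetry makes all these
    choices equal. *)
Lemma coef1_expansion x y m r : K x -> K y ->
  {in r, forall x, K x} -> (m.+1 + size r)%N = d ->
  (expansion x y m.+1 r)`_1 = m.+1%:R * Phi (nseq m x ++ y :: r).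
Proof.
move=> Kx Ky; elim: m r => [|m IH] r Kr szr.
  by rewrite /= coefD coefC coefXM coefC add0r mul1r.
rewrite [expansion _ _ _ _]/= coefD coefXM /= -/(expansion x y m.+1 _) IH /=; first last.
- by rewrite addnS.
- exact: in_consK.
have := coef0_expansion x y m.+1 (y :: r) => /= ->.
rewrite -[in RHS]natr1 mulrDl mul1r; congr (_ * _ + _).
apply: Phi_perm; rewrite ?size_cat ?size_nseq /= ?addnS //.
  by apply: in_nseqK => //; apply: in_consK => //; exact: in_consK.
by apply/seq.permP => a; rewrite /= !count_cat /=; lia.
Qed.

(** Lists of the form [nseq n x ++ l] are treated by induction on [l], from the diagonal on. With
    [n.+1] copies of [comb k x y] the expansion vanishes for all [k >= 0], hence so does its linear
    coefficient, which is [n.+1] times the value with one entry turned into [y]. *)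
Lemma polarization_eq0 l : {in l, forall x, K x} -> size l = d -> Phi l = 0.
Proof.
suff H n : {in l, forall x, K x} -> (n + size l)%N = d ->
    forall x, K x -> Phi (nseq n x ++ l) = 0.
  by move=> Kl szl; exact: (H 0 Kl szl x0 Kx0).
elim: l n => [|y l IH] n Kl szl x Kx.
  by rewrite cats0 -(_ : d = n) ?Phi_diag // -szl addn0.
have Ky : K y by apply: Kl; rewrite mem_head.
have Kl' : {in l, forall x, K x} by move=> z zl; apply: Kl; rewrite inE zl orbT.
have szl' : (n.+1 + size l)%N = d by rewrite addSnnS.
have p0 : expansion x y n.+1 l = 0.
  apply: poly_eq0_nonneg => k k0; rewrite horner_expansion //.
  by apply: IH => //; exact: Kcomb.
have := coef1_expansion Kx Ky Kl' szl'; rewrite p0 coef0 => /esym/eqP.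
by rewrite mulf_eq0 pnatr_eq0 /= => /eqP.
Qed.

End Polarization.

(** * Cones of a fan *)

Section Spans.
Context {R : realType} {N : vectType R}.

Lemma lspan_sub (A : set N) v : A v -> v \in lspan A.
Proof. by have [+ _] := lspanP A; apply. Qed.

Lemma lspan_eq (A : set N) (V : {vspace N}) :
  (forall v, A v -> v \in V) ->
  (forall W : {vspace N}, (forall v, A v -> v \in W) -> (V <= W)%VS) ->
  lspan A = V.
Proof.
move=> AV minV; have [AL minL] := lspanP A; apply/eqP.
by rewrite eqEsubv minL // minV.
Qed.

Lemma polyhedral_cone_comb (C : set N) a b x y : polyhedral_cone C ->
  0 <= a -> 0 <= b -> C x -> C y -> C (a *: x + b *: y).
Proof.
move=> [s ->] a0 b0 [c c0 ->] [e e0 ->].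
exists (fun i => a * c i + b * e i).
  by move=> i; rewrite addr_ge0 // mulr_ge0.
rewrite !scaler_sumr -big_split; apply: eq_bigr => i _.
by rewrite /= !scalerA -scalerDl.
Qed.

End Spans.

Section FanCones.
Context {R : realType} {N : vectType R}.
Variable Sigma : fan N.
Implicit Types (C : set N) (rho : rays Sigma).

Lemma cone_comb C a b x y : C \in cones Sigma ->
  0 <= a -> 0 <= b -> C x -> C y -> C (a *: x + b *: y).
Proof. by move=> /fan_polyhedral; exact: polyhedral_cone_comb. Qed.

Lemma cone0 C : C \in cones Sigma -> C 0.
Proof.
move=> /fan_polyhedral[s ->]; exists (fun=> 0) => //.
by rewrite big1 // => i _; rewrite scale0r.
Qed.

Lemma coneZ C a x : C \in cones Sigma -> 0 <= a -> C x -> C (a *: x).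
Proof.
move=> CS a0 Cx; have := cone_comb CS a0 (lexx 0) Cx Cx.
by rewrite scale0r addr0.
Qed.

Lemma coneD C x y : C \in cones Sigma -> C x -> C y -> C (x + y).
Proof.
move=> CS Cx Cy; have := cone_comb CS ler01 ler01 Cx Cy.
by rewrite !scale1r.
Qed.

Lemma cone_sum C (I : Type) (r : seq I) (P : pred I) (F : I -> N) :
  C \in cones Sigma -> (forall i, P i -> C (F i)) -> C (\sum_(i <- r | P i) F i).
Proof.
move=> CS CF; apply: big_ind => //; [exact: cone0|by move=> x y; exact: coneD].
Qed.

Lemma ray_cone rho : val rho \in cones Sigma.
Proof. by have := valP rho; rewrite !inE => /andP[]. Qed.

Lemma ray_dim rho : cdim (val rho) = 1%N.
Proof. by have := valP rho; rewrite !inE => /andP[_ /eqP]. Qed.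

Lemma mark_in rho : (val rho) (mark rho).
Proof. by have [] := markP rho. Qed.

Lemma mark_neq0 rho : mark rho != 0.
Proof. by have [] := markP rho. Qed.

(** The ray spans the line of its mark, and a negative multiple would put [- mark rho] into the ray,
    against pointedness. *)
Lemma ray_mark rho v : (val rho) v -> exists2 a, 0 <= a & v = a *: mark rho.
Proof.
move=> rv; have L : lspan (val rho) = <[mark rho]>%VS.
  apply/esym/eqP; rewrite eqEdim dim_vline mark_neq0 -/(cdim _) ray_dim leqnn andbT.
  by rewrite -memvE; exact/lspan_sub/mark_in.
have : v \in <[mark rho]>%VS by rewrite -L; exact: lspan_sub.
case/vlineP => a va; exists a => //; rewrite leNgt; apply/negP => a0.
have := mark_neq0 rho; rewrite (@fan_pointed _ _ Sigma _ (ray_cone rho) (mark rho)) ?eqxx //.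
  exact: mark_in.
have -> : - mark rho = (- a)^-1 *: v.
  by rewrite va scalerA invrN mulNr mulVf ?lt_eqF // scaleN1r.
by apply: coneZ (ray_cone rho) _ rv; rewrite invr_ge0 oppr_ge0 ltW.
Qed.

Definition ray_hull (S : pred (rays Sigma)) : set N :=
  [set v | exists c : rays Sigma -> R,
     [/\ forall rho, 0 <= c rho, forall rho, ~~ S rho -> c rho = 0
       & v = \sum_rho c rho *: mark rho]]%classic.

Lemma ray_hull_comb S a b x y : 0 <= a -> 0 <= b ->
  ray_hull S x -> ray_hull S y -> ray_hull S (a *: x + b *: y).
Proof.
move=> a0 b0 [c [c0 cN ->]] [e [e0 eN ->]].
exists (fun rho => a * c rho + b * e rho); split.
- by move=> rho; rewrite addr_ge0 // mulr_ge0.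
- by move=> rho rS; rewrite cN // eN // !mulr0 addr0.
- rewrite !scaler_sumr -big_split; apply: eq_bigr => i _.
  by rewrite /= !scalerA -scalerDl.
Qed.

Lemma ray_hull0 S : ray_hull S 0.
Proof.
exists (fun=> 0); split => //.
by rewrite big1 // => i _; rewrite scale0r.
Qed.

Lemma ray_hull_mark (S : pred (rays Sigma)) rho : S rho -> ray_hull S (mark rho).
Proof.
move=> Sr; exists (fun r => (r == rho)%:R); split.
- by move=> r; exact: ler0n.
- by move=> r; apply: contraNeq; rewrite pnatr_eq0 eqb0 negbK => /eqP ->.
- rewrite (bigD1 rho) //= eqxx scale1r big1 ?addr0 // => r /negbTE ->.
  by rewrite scale0r.
Qed.

Lemma ray_hull_sub (S : pred (rays Sigma)) C : C \in cones Sigma ->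
  (forall rho, S rho -> C (mark rho)) -> (ray_hull S `<=` C)%classic.
Proof.
move=> CS SC v [c [c0 cN ->]]; apply: cone_sum => // rho _.
have [Sr|Sr] := boolP (S rho); first exact: coneZ (SC _ Sr).
by rewrite cN // scale0r; exact: cone0.
Qed.

Lemma cone_rays_mark C rho : cone_rays C rho -> C (mark rho).
Proof. by move=> /asboolP[+ _ _ _]; apply; exact: mark_in. Qed.

Section Generators.
Variables (C : set N) (s : seq N).
Hypothesis CS : C \in cones Sigma.
Hypothesis CE : C = cone_of s.

Let generated (A : {set 'I_(size s)}) : Prop := forall v, C v ->
  exists c : 'I_(size s) -> R, [/\ forall i, 0 <= c i,
    forall i, i \notin A -> c i = 0 & v = \sum_i c i *: s`_i].

Let gen_in (i : 'I_(size s)) : C s`_i.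
Proof.
rewrite CE; exists (fun j => (j == i)%:R) => [j|]; first exact: ler0n.
rewrite (bigD1 i) //= eqxx scale1r big1 ?addr0 // => j /negbTE ->.
by rewrite scale0r.
Qed.

(* A generator lying on no extremal ray is a combination of the others. *)
Lemma minimal_generator_face (A : {set 'I_(size s)}) i : generated A -> i \in A ->
  ~ generated (A :\ i) -> face (cone_of [:: s`_i]) C /\ s`_i != 0.
Proof.
move=> gA iA ngA.
have cone1 v : cone_of [:: s`_i] v <-> exists2 a, 0 <= a & v = a *: s`_i.
  split=> [[c c0 ->]|[a a0 ->]].
    by exists (c ord0) => //; rewrite big_ord1.
  by exists (fun=> a) => //; rewrite big_ord1.
have redundant (e : 'I_(size s) -> R) : (forall j, 0 <= e j) ->
    (forall j, j \notin A :\ i -> e j = 0) -> s`_i <> \sum_j e j *: s`_j.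
  move=> e0 eN sE; apply: ngA => v /gA[c [c0 cN ->]].
  exists (fun j => if j == i then 0 else c j + c i * e j); split.
  - by move=> j; case: eqP => // _; rewrite addr_ge0 // mulr_ge0.
  - move=> j jA; case: eqVneq => // ji; rewrite (eN j jA) mulr0 addr0 cN //.
    by apply: contraNN jA => jA; rewrite inE jA inE ji.
  - rewrite (bigD1 i) //= {1}sE (bigD1 i) //= (eN i) ?setD11 // scale0r add0r.
    rewrite [RHS](bigD1 i) //= eqxx scale0r add0r scaler_sumr -big_split /=.
    apply: eq_bigr => j /negbTE ->.
    by rewrite scalerA -scalerDl addrC.
have si0 : s`_i != 0.
  apply/eqP => si0; apply: (redundant (fun=> 0)) => //.
  by rewrite big1 // => j _; rewrite scale0r.
split => //; split.
- by move=> v /cone1[a a0 ->]; exact: coneZ.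
- by apply/cone1; exists 0; rewrite ?scale0r.
- move=> a b x y a0 b0 /cone1[p p0 ->] /cone1[q q0 ->].
  apply/cone1; exists (a * p + b * q); first by rewrite addr_ge0 // mulr_ge0.
  by rewrite !scalerA -scalerDl.
move=> x y Cx Cy /cone1[a a0 xyE].
have [c [c0 cN xE]] := gA _ Cx; have [e [e0 eN yE]] := gA _ Cy.
pose b j := c j + e j.
have b0 j : 0 <= b j by exact: addr_ge0.
(* Comparing the two expressions of [x + y] isolates the [i]-th generator. A positive factor makes
   it redundant; otherwise each [b j] term has its negative in [C] as well, and pointedness makes it
   vanish. *)
have sumE : (a - b i) *: s`_i = \sum_(j | j != i) b j *: s`_j.
  rewrite scalerBl -xyE xE yE -big_split (bigD1 i) //= -scalerDl -/(b i) addrAC subrr add0r.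
  by apply: eq_bigr => j _; rewrite -scalerDl.
have [ab|ab] := ltP 0 (a - b i).
  case: (redundant (fun j => if j == i then 0 else b j / (a - b i))).
  - by move=> j; case: eqP => // _; rewrite divr_ge0 // ltW.
  - move=> j jA; case: eqVneq => // ji; rewrite /b (cN j) ?(eN j) ?add0r ?mul0r //;
    by apply: contraNN jA => jA; rewrite inE jA inE ji.
  - rewrite (bigD1 i) //= eqxx scale0r add0r.
    apply: (scalerI (lt0r_neq0 ab)); rewrite sumE scaler_sumr.
    by apply: eq_bigr => j /negbTE ->; rewrite scalerA mulrC divfK // gt_eqF.
have bs0 j : j != i -> b j *: s`_j = 0.
  move=> ji; apply: (fan_pointed CS); first exact: coneZ.
  have -> : - (b j *: s`_j) =
      \sum_(k | (k != i) && (k != j)) b k *: s`_k + (b i - a) *: s`_i.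
    have -> : (b i - a) *: s`_i = - ((a - b i) *: s`_i) by rewrite -scaleNr opprB.
    by rewrite sumE [X in _ = _ - X](bigD1 j) //= opprD addrCA subrr addr0.
  apply: coneD => //; last by apply: coneZ => //; rewrite subr_ge0 -subr_le0.
  by apply: cone_sum => // k _; exact: coneZ.
have zero (f : 'I_(size s) -> R) j : j != i -> f j <= b j -> 0 <= f j -> f j *: s`_j = 0.
  move=> ji fb f0; have /eqP := bs0 _ ji; rewrite scaler_eq0 => /orP[/eqP bj0|/eqP ->].
    have -> : f j = 0 by apply/eqP; rewrite eq_le f0 andbT -bj0.
    by rewrite scale0r.
  by rewrite scaler0.
split; apply/cone1.
  exists (c i) => //; rewrite xE (bigD1 i) //= big1 ?addr0 // => j ji.
  by apply: zero; rewrite // lerDl.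
exists (e i) => //; rewrite yE (bigD1 i) //= big1 ?addr0 // => j ji.
by apply: zero; rewrite // lerDr.
Qed.

(** In a generating set of least cardinality no generator is redundant, so each spans an extremal
    ray. That ray is a face, hence a ray of the fan, and the generator is a multiple of its mark. *)
Lemma cone_sub_ray_hull : (C `<=` ray_hull (cone_rays C))%classic.
Proof.
have gT : generated [set: 'I_(size s)]%SET.
  rewrite /generated {1}CE => v [c c0 ->]; exists c; split => // i.
  by rewrite finset.in_setT.
have Pgt : `[< generated [set: 'I_(size s)]%SET >] by exact/asboolP.
case: (@arg_minnP _ _ (fun A => `[< generated A >]) (fun A => #|A|) Pgt).
move=> A /asboolP gA minA.
move=> v /gA[c [c0 cN ->]].
apply: big_ind => [|x y hx hy|i _]; first exact: ray_hull0.
  by have := ray_hull_comb ler01 ler01 hx hy; rewrite !scale1r.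
have [iA|iA] := boolP (i \in A); last by rewrite cN // scale0r; exact: ray_hull0.
have ngA : ~ generated (A :\ i).
  move=> /asboolP /minA; apply/negP; rewrite -ltnNge.
  by rewrite [X in (_ < X)%N](cardsD1 i) iA.
have [fB si0] := minimal_generator_face gA iA ngA.
have BS := fan_face CS fB.
have Bray : cone_of [:: s`_i] \in rays Sigma.
  rewrite !inE BS /=; apply/eqP; rewrite /cdim (@lspan_eq _ _ _ <[s`_i]>%VS).
  - by rewrite dim_vline si0.
  - by move=> x [e _ ->]; rewrite big_ord1 memvZ ?memv_line.
  - move=> W BW; rewrite -memvE; apply: BW; exists (fun=> 1) => //.
    by rewrite big_ord1 scale1r.
pose rho : rays Sigma := FSetSub Bray.
have rC : cone_rays C rho by exact/asboolP.
have [e e0 me] := mark_in rho; rewrite big_ord1 /= in me.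
have e0' : e ord0 != 0.
  by apply: contraNneq (mark_neq0 rho) => e00; rewrite me e00 scale0r.
have -> : c i *: s`_i = (c i / e ord0) *: mark rho + 0 *: mark rho.
  by rewrite me scale0r addr0 scalerA divfK.
apply: ray_hull_comb => //; try exact: ray_hull_mark.
by rewrite divr_ge0.
Qed.

End Generators.

Lemma cone_ray_hull C : C \in cones Sigma -> C = ray_hull (cone_rays C).
Proof.
move=> CS; apply/seteqP; split; last first.
  by apply: ray_hull_sub => // rho; exact: cone_rays_mark.
by have [s CE] := fan_polyhedral CS; exact: cone_sub_ray_hull CS CE.
Qed.

End FanCones.

(** * Faces and normal points in a simplicial fan *)

Section SimplicialFan.
Context {R : realType} {N : vectType R}.
Variables (Sigma : fan N) (ip : {dot N for @idfun R}).
Hypothesis simp : simplicial Sigma.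
Implicit Types (C : set N) (rho : rays Sigma).

Definition cone_mark C (k : 'I_#|@cone_rays _ _ Sigma C|) : N := mark (enum_val k).

Lemma cone_mark_enum C rho : cone_rays C rho ->
  exists k : 'I_#|@cone_rays _ _ Sigma C|, enum_val k = rho.
Proof. by move=> rC; exists (enum_rank_in rC rho); rewrite enum_rankK_in. Qed.

Lemma cone_rays_enum C (k : 'I_#|@cone_rays _ _ Sigma C|) : cone_rays C (enum_val k).
Proof. exact: (@enum_valP _ (cone_rays C) k). Qed.

Lemma cone_mark_in C k : C (cone_mark (C := C) k).
Proof. exact: cone_rays_mark (cone_rays_enum k). Qed.

Lemma sum_cone_mark C (c : rays Sigma -> R) :
  (forall rho, ~~ cone_rays C rho -> c rho = 0) ->
  \sum_rho c rho *: mark rho = \sum_k c (enum_val k) *: cone_mark (C := C) k.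
Proof.
move=> cN; rewrite (bigID (cone_rays C)) /= addrC big1 ?add0r.
  exact: (@big_enum_val _ _ _ _ (cone_rays C) (fun rho => c rho *: mark rho)).
by move=> rho /cN ->; rewrite scale0r.
Qed.

Lemma cone_hull C v : C \in cones Sigma -> C v -> ray_hull (@cone_rays _ _ Sigma C) v.
Proof. by move=> CS; rewrite -(cone_ray_hull CS). Qed.

Lemma cone_pcone C v : C \in cones Sigma -> C v <-> pcone (@cone_mark C) v.
Proof.
move=> CS; split.
  move=> /(cone_hull CS)[c [c0 cN ->]].
  by rewrite (sum_cone_mark cN); exists (fun k => c (enum_val k)).
move=> [c c0 ->]; apply: (cone_sum _ CS) => k _; apply: (coneZ CS) => //.
exact: cone_mark_in.
Qed.

Let mark_tuple C : #|@cone_rays _ _ Sigma C|.-tuple N :=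
  [tuple cone_mark k | k < #|@cone_rays _ _ Sigma C|].

Let nth_mark_tuple C (k : 'I_#|@cone_rays _ _ Sigma C|) :
  (mark_tuple C)`_k = cone_mark k.
Proof. by rewrite -tnth_nth tnth_mktuple. Qed.

Lemma lspan_cone C : C \in cones Sigma -> lspan C = <<mark_tuple C>>%VS.
Proof.
move=> CS; apply: lspan_eq => [v|W CW].
  move=> /(cone_pcone _ CS)[c _ ->]; apply: memv_suml => k _.
  by apply/memvZ/memv_span; rewrite -(tnth_mktuple (@cone_mark C) k) mem_tnth.
apply/span_subvP => v /mapP[k _ ->]; apply: CW.
exact: cone_mark_in.
Qed.

Lemma lspan_coord C v : C \in cones Sigma -> v \in lspan C ->
  exists c, v = \sum_k c k *: cone_mark (C := C) k.
Proof.
move=> CS; rewrite lspan_cone // => /coord_span ->.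
by exists (fun k => coord (mark_tuple C) k v); apply: eq_bigr => k _;
  rewrite nth_mark_tuple.
Qed.

Lemma lin_indep_cone C : C \in cones Sigma -> lin_indep (@cone_mark C).
Proof.
move=> CS c c0; have fr : free (mark_tuple C).
  by rewrite /free -lspan_cone // -/(cdim C) simp // size_tuple.
move/freeP: fr => /(_ c); apply; rewrite -[RHS]c0; apply: eq_bigr => k _.
by rewrite nth_mark_tuple.
Qed.

Lemma lspan_orth C v : C \in cones Sigma -> v \in lspan C ->
  (forall rho, cone_rays C rho -> ip v (mark rho) = 0) -> v = 0.
Proof.
move=> CS /(lspan_coord CS)[c vE] v0; apply: (ip_eq0 (ip := ip)).
rewrite {2}vE ip_sumr big1 // => k _.
by rewrite ipZr v0 ?mulr0 //; exact: cone_rays_enum.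
Qed.

Lemma normal_pointP C z : C \in cones Sigma ->
  normal_point ip C z \in lspan C /\
  forall rho, cone_rays C rho -> ip (normal_point ip C z) (mark rho) = z rho.
Proof.
move=> CS; apply: (@xgetPex _ _ [set w | w \in lspan C /\
   forall rho, cone_rays C rho -> ip w (mark rho) = z rho]%classic).
have [M MP] := gram_solve ip (lin_indep_cone CS).
pose t (k : 'I_#|@cone_rays _ _ Sigma C|) := z (enum_val k).
pose c k := \sum_j M k j * t j.
exists (\sum_k c k *: cone_mark k); split.
  apply: memv_suml => k _; apply/memvZ/lspan_sub.
  exact: cone_mark_in.
have cE : forall j, ip (\sum_k c k *: cone_mark k) (cone_mark j) = t j by apply/MP.
by move=> rho /cone_mark_enum[k <-]; exact: cE.
Qed.

Lemma normal_point_unique C z w : C \in cones Sigma -> w \in lspan C ->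
  (forall rho, cone_rays C rho -> ip w (mark rho) = z rho) ->
  normal_point ip C z = w.
Proof.
move=> CS wL wz; have [pL pz] := normal_pointP z CS.
apply/eqP; rewrite -subr_eq0; apply/eqP; apply: (lspan_orth CS).
  exact: rpredB.
by move=> rho rC; rewrite ipBl pz // wz // subrr.
Qed.

Definition val_comb (a b : R) (z1 z2 : rays Sigma -> R) : rays Sigma -> R :=
  fun rho => a * z1 rho + b * z2 rho.

Lemma pseudocubical_comb a b z1 z2 : 0 <= a -> 0 <= b ->
  pseudocubical ip z1 -> pseudocubical ip z2 ->
  pseudocubical ip (val_comb a b z1 z2).
Proof.
move=> a0 b0 c1 c2 C CS.
have [L1 p1] := normal_pointP z1 CS; have [L2 p2] := normal_pointP z2 CS.
rewrite (@normal_point_unique C _ (a *: normal_point ip C z1 + b *: normal_point ip C z2)) //.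
- by apply: (cone_comb CS) => //; [exact: (c1 C CS)|exact: (c2 C CS)].
- by rewrite rpredD ?rpredZ.
- by move=> rho rC; rewrite ipDl !ipZl p1 // p2.
Qed.

Lemma pseudocubical0 : pseudocubical ip (fun _ : rays Sigma => 0).
Proof.
move=> C CS; rewrite (@normal_point_unique C _ 0) ?mem0v //; first exact: cone0 CS.
by move=> rho _; rewrite ip0l.
Qed.

(** Any set of rays of a simplicial cone spans a face: coefficients are unique, so off [S] those of
    [x] and [y] are nonnegative with sum zero. *)
Lemma ray_hull_fan C (S : pred (rays Sigma)) : C \in cones Sigma ->
  (forall rho, S rho -> cone_rays C rho) -> ray_hull S \in cones Sigma.
Proof.
move=> CS SC; apply: (fan_face CS); split.
- by apply: ray_hull_sub => // rho /SC; exact: cone_rays_mark.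
- exact: ray_hull0.
- by move=> a b x y; exact: ray_hull_comb.
move=> x y /(cone_hull CS)[c [c0 cN xE]] /(cone_hull CS)[e [e0 eN yE]].
move=> [f [f0 fN xyE]].
have fNC rho : ~~ cone_rays C rho -> f rho = 0.
  by move=> rC; apply: fN; apply: contraNN rC; exact: SC.
have ce_f rho : c rho + e rho = f rho.
  have [rC|rC] := boolP (cone_rays C rho); last by rewrite cN ?eN ?fNC ?addr0.
  have [k <-] := cone_mark_enum rC.
  have := lin_indep_cone CS (c := fun k => c (enum_val k) + e (enum_val k) - f (enum_val k)).
  move=> /(_ _ k) h; apply/eqP; rewrite -subr_eq0; apply/eqP; apply: h.
  under eq_bigr do rewrite scalerBl scalerDl.
  rewrite sumrB big_split /=.
  by rewrite -(sum_cone_mark cN) -(sum_cone_mark eN) -(sum_cone_mark fNC) -xE -yE -xyE subrr.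
have ce0 rho : ~~ S rho -> c rho = 0 /\ e rho = 0.
  move=> /fN frho; have := ce_f rho; rewrite frho => /eqP.
  by rewrite paddr_eq0 // => /andP[/eqP -> /eqP ->].
split; [exists c|exists e]; split => // rho /ce0[] //.
Qed.

(** The ray lies inside the cone, so it is their intersection, which the fan axioms make a face. *)
Lemma ray_hull_rays (S : pred (rays Sigma)) rho :
  ray_hull S \in cones Sigma -> S rho -> cone_rays (ray_hull S) rho.
Proof.
move=> BS Sr; apply/asboolP.
have := fan_meet BS (ray_cone rho); rewrite setIidr // => v /ray_mark[a a0 ->].
by apply: (coneZ BS) => //; exact: ray_hull_mark.
Qed.

Definition cone_vertex C (z : rays Sigma -> R)
    (tau : {set 'I_#|@cone_rays _ _ Sigma C|}) : N :=
  normal_point ip (ray_hull [pred rho | [exists k in tau, enum_val k == rho]]) z.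

(** The face spanned by [tau] is itself a cone of the fan, so pseudocubicality applies to its normal
    point. *)
Lemma cone_vertices C (z : rays Sigma -> R) : C \in cones Sigma -> pseudocubical ip z ->
  vertices ip (@cone_mark C) (fun k => z (enum_val k)) (cone_vertex z (C := C)).
Proof.
move=> CS zc tau; rewrite /cone_vertex; set S := [pred rho | _].
have SC rho : S rho -> cone_rays C rho.
  by move=> /exists_inP[k _ /eqP <-]; exact: cone_rays_enum.
have BS := ray_hull_fan CS SC.
split.
  have [c [c0 cN ->]] := zc _ BS.
  exists (fun k => c (enum_val k)); split => //.
    move=> k kN; apply: cN; apply/negP => /exists_inP[k' k't /eqP].
    by move=> /enum_val_inj kk; rewrite -kk k't in kN.
  apply: sum_cone_mark => rho rC; apply: cN; apply: contraNN rC; exact: SC.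
move=> k kt; have [_ ->] // := normal_pointP z BS.
by apply: (ray_hull_rays BS); apply/exists_inP; exists k.
Qed.

Lemma normal_polytopeE C (z : rays Sigma -> R) : C \in cones Sigma ->
  normal_polytope ip C z = normal_poly ip (@cone_mark C) (fun k => z (enum_val k)).
Proof.
move=> CS; apply/seteqP; split => v [vC vz]; split.
- exact/(cone_pcone v CS).
- by move=> k; apply: vz; exact: cone_rays_enum.
- exact/(cone_pcone v CS).
- by move=> rho /cone_mark_enum[k <-]; exact: vz.
Qed.

End SimplicialFan.

(** * Normal polytopes as convex hulls, and their Minkowski sums *)

Section NormalPolytopes.
Context {R : realType} {N : vectType R}.
Variable ip : {dot N for @idfun R}.

Lemma convex_conv_hull (s : seq N) : convex (conv_hull s).
Proof.
move=> t x y t0 t1 [c [c0 c1 ->]] [e [e0 e1 ->]].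
exists (fun i => t * c i + (1 - t) * e i); split.
- by move=> i; rewrite addr_ge0 // mulr_ge0 // subr_ge0.
- by rewrite big_split /= -!mulr_sumr c1 e1 !mulr1 addrC subrK.
- rewrite !scaler_sumr -big_split; apply: eq_bigr => i _.
  by rewrite /= !scalerA -scalerDl.
Qed.

Lemma conv_hull_mem (s : seq N) x : x \in s -> conv_hull s x.
Proof.
move=> xs; have xs' : (index x s < size s)%N by rewrite index_mem.
exists (fun i => (i == Ordinal xs')%:R); split.
- by move=> i; exact: ler0n.
- by rewrite (bigD1 (Ordinal xs')) //= eqxx big1 ?addr0 // => i /negbTE ->.
- rewrite (bigD1 (Ordinal xs')) //= eqxx scale1r nth_index // big1 ?addr0 //.
  by move=> i /negbTE ->; rewrite scale0r.
Qed.

Lemma pcone_sum d (u : 'I_d -> N) (I : Type) (r : seq I) (c : I -> R) (F : I -> N) :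
  (forall i, 0 <= c i) -> (forall i, pcone u (F i)) ->
  pcone u (\sum_(i <- r) c i *: F i).
Proof.
move=> c0 FC; apply: big_ind => [|x y [a a0 ->] [b b0 ->]|i _].
- by exists (fun=> 0) => //; rewrite big1 // => i _; rewrite scale0r.
- exists (fun i => a i + b i); first by move=> i; rewrite addr_ge0.
  by rewrite -big_split; apply: eq_bigr => i _; rewrite scalerDl.
- have [a a0 ->] := FC i; exists (fun j => c i * a j).
    by move=> j; rewrite mulr_ge0.
  by rewrite scaler_sumr; apply: eq_bigr => j _; rewrite scalerA.
Qed.

Lemma normal_poly_hull d (u : 'I_d -> N) z w : vertices ip u z w ->
  normal_poly ip u z = conv_hull [seq w tau | tau <- enum {set 'I_d}].
Proof.
move=> uzw; apply/seteqP; split.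
  apply: (normal_poly_sub_hull uzw); first exact: convex_conv_hull.
  by move=> tau; apply/conv_hull_mem/map_f; rewrite mem_enum.
move=> v [c [c0 c1 ->]]; set s := [seq _ | _ <- _] in c c0 c1 *.
have sP i : normal_poly ip u z s`_(i : 'I_(size s)).
  have /mapP[tau _ ->] : s`_i \in s by rewrite mem_nth.
  exact: vertices_normal_poly uzw.
split; first by apply: pcone_sum => // i; have [] := sP i.
move=> j; rewrite ip_suml -[leRHS]mul1r -c1 mulr_suml; apply: ler_sum => i _.
by rewrite ipZl ler_wpM2l //; have [_] := sP i; apply.
Qed.

Lemma normal_poly_polytope d (u : 'I_d -> N) z w : vertices ip u z w ->
  polytope (normal_poly ip u z).
Proof.
move=> uzw; rewrite (normal_poly_hull uzw); eexists; last reflexivity.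
rewrite -size_eq0 size_map -cardE -lt0n.
by apply/card_gt0P; exists finset.set0.
Qed.

Lemma vertices_comb d (u : 'I_d -> N) z1 w1 z2 w2 a b : 0 <= a -> 0 <= b ->
  vertices ip u z1 w1 -> vertices ip u z2 w2 ->
  vertices ip u (fun j => a * z1 j + b * z2 j)
    (fun tau => a *: w1 tau + b *: w2 tau).
Proof.
move=> a0 b0 v1 v2 tau.
have [[c [c0 cN ->]] wz1] := v1 tau; have [[e [e0 eN ->]] wz2] := v2 tau.
split.
  exists (fun i => a * c i + b * e i); split.
  - by move=> i; rewrite addr_ge0 // mulr_ge0.
  - by move=> i it; rewrite cN // eN // !mulr0 addr0.
  - rewrite !scaler_sumr -big_split; apply: eq_bigr => i _.
    by rewrite /= !scalerA -scalerDl.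
by move=> j jt; rewrite ipDl !ipZl wz1 // wz2.
Qed.

(** The inclusion from left to right is termwise. The other one fails for general values; here it
    holds because the vertices combine like the values and the Minkowski combination is convex. *)
Lemma normal_poly_minkowski d (u : 'I_d -> N) z1 w1 z2 w2 a b :
  0 <= a -> 0 <= b -> vertices ip u z1 w1 -> vertices ip u z2 w2 ->
  minkowski_comb a b (normal_poly ip u z1) (normal_poly ip u z2) =
  normal_poly ip u (fun j => a * z1 j + b * z2 j).
Proof.
move=> a0 b0 v1 v2; apply/seteqP; split.
  move=> v [x [y [[[c c0 ->] xz] [[e e0 ->] yz] ->]]]; split.
    exists (fun i => a * c i + b * e i).
      by move=> i; rewrite addr_ge0 // mulr_ge0.
    rewrite !scaler_sumr -big_split; apply: eq_bigr => i _.
    by rewrite /= !scalerA -scalerDl.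
  by move=> j; rewrite ipDl !ipZl lerD // ler_wpM2l.
apply: (normal_poly_sub_hull (vertices_comb a0 b0 v1 v2)).
  move=> t x y t0 t1 [x1 [x2 [x1P x2P ->]]] [y1 [y2 [y1P y2P ->]]].
  exists (t *: x1 + (1 - t) *: y1), (t *: x2 + (1 - t) *: y2); split.
  - exact: convex_normal_poly.
  - exact: convex_normal_poly.
  - by rewrite !scalerDr !scalerA addrACA !(mulrC _ t) !(mulrC _ (1 - t)).
move=> tau; exists (w1 tau), (w2 tau); split => //.
  exact: vertices_normal_poly v1.
exact: vertices_normal_poly v2.
Qed.

End NormalPolytopes.

(** * Normalized volume of the polytope in one cone *)

Section ConeVolume.
Context {R : realType} {N : vectType R}.
Variables (Sigma : fan N) (ip : {dot N for @idfun R}).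
Hypothesis simp : simplicial Sigma.
Implicit Types (C : set N) (rho : rays Sigma).

Lemma lebesgue_tuple_coord (s : seq N) n (ns : size s = n) (A : set N) :
  lebesgue_tuple [set t : (size s).-tuple R | A (\sum_i tnth t i *: s`_i)]%classic =
  lebesgue_tuple [set t : n.-tuple R | A (\sum_i tnth t i *: s`_i)]%classic.
Proof. by case: _ / ns. Qed.

Lemma size_dual_basis C : size (dual_basis Sigma ip C) =
  #|@cone_rays _ _ Sigma C|.
Proof. by rewrite size_map -cardE. Qed.

Definition dual_mark C (k : 'I_#|@cone_rays _ _ Sigma C|) : N :=
  dual_vector ip C (enum_val k).

Lemma nth_dual_basis C (k : 'I_#|@cone_rays _ _ Sigma C|) :
  (dual_basis Sigma ip C)`_k = dual_mark k.
Proof.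
rewrite (nth_map (enum_val k)) ?size_map -?cardE //.
by rewrite -enum_val_nth.
Qed.

Lemma dual_markP C j k : C \in cones Sigma ->
  ip (dual_mark (C := C) k) (cone_mark j) = (j == k)%:R.
Proof.
move=> CS; have [_ h] := normal_pointP ip simp (fun rho => (rho == enum_val k)%:R) CS.
by rewrite h ?cone_rays_enum // (inj_eq enum_val_inj).
Qed.

Lemma dual_sumP C (t : 'I_#|@cone_rays _ _ Sigma C| -> R) j : C \in cones Sigma ->
  ip (\sum_k t k *: dual_mark k) (cone_mark j) = t j.
Proof.
move=> CS; rewrite ip_suml (bigD1 j) //= ipZl dual_markP // eqxx mulr1.
by rewrite big1 ?addr0 // => k kj; rewrite ipZl dual_markP // eq_sym (negbTE kj) mulr0.
Qed.

Lemma dual_sum_lspan C (t : 'I_#|@cone_rays _ _ Sigma C| -> R) : C \in cones Sigma ->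
  \sum_k t k *: dual_mark k \in lspan C.
Proof.
move=> CS; apply: memv_suml => k _; apply: memvZ.
by have [] := normal_pointP ip simp (fun rho => (rho == enum_val k)%:R) CS.
Qed.

Lemma lattice_volumeE C (A : set N) : lattice_volume Sigma ip C A =
  fine (lebesgue_tuple [set t : #|@cone_rays _ _ Sigma C|.-tuple R |
    A (\sum_k tnth t k *: dual_mark k)]%classic).
Proof.
rewrite /lattice_volume (lebesgue_tuple_coord (size_dual_basis C)).
congr (fine (lebesgue_tuple _)); apply/funext => t /=; congr A.
by apply: eq_bigr => k _; rewrite nth_dual_basis.
Qed.

(** The constant by which [cone_volume] divides; it cancels the factorial in [lebesgue_tpoly]. *)
Lemma lattice_volume_simplex C : C \in cones Sigma ->
  lattice_volume Sigma ip C
    (conv_hull (0 :: dual_basis Sigma ip C)) =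
  ((#|@cone_rays _ _ Sigma C|)`!%:R)^-1.
Proof.
move=> CS; rewrite lattice_volumeE; set n := #|_|.
have -> : [set t : n.-tuple R | conv_hull (0 :: dual_basis Sigma ip C)
      (\sum_k tnth t k *: dual_mark k)]%classic =
    [set t | (forall i, 0 <= tnth t i) /\ \sum_i tnth t i <= 1]%classic.
  apply/seteqP; split => t /=.
    move=> [c [c0]]; rewrite !big_ord_recl scaler0 add0r => c1 tE.
    pose f (k : 'I_n) := cast_ord (esym (size_dual_basis C)) k.
    have reind (V : nmodType) (F : 'I_(size (dual_basis Sigma ip C)) -> V) :
        \sum_i F i = \sum_(k < n) F (f k).
      apply: reindex; exists (cast_ord (size_dual_basis C)) => i _.
        exact: cast_ordKV.
      exact: cast_ordK.
    have tc k : tnth t k = c (lift ord0 (f k)).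
      rewrite -(dual_sumP (tnth t) k CS) tE reind.
      rewrite (eq_bigr (fun k => c (lift ord0 (f k)) *: dual_mark k)) ?dual_sumP //.
      by move=> i _; rewrite -nth_dual_basis.
    split=> [k|]; first by rewrite tc.
    rewrite (eq_bigr _ (fun k _ => tc k)) -(reind R (fun i => c (lift ord0 i))).
    by rewrite -c1 lerDr.
  move=> [t0 t1].
  pose g (i : 'I_(size (dual_basis Sigma ip C))) := tnth t (cast_ord (size_dual_basis C) i).
  have reind (V : nmodType) (F : 'I_n -> V) :
      \sum_i F (cast_ord (size_dual_basis C) i) = \sum_k F k.
    apply/esym/reindex; exists (cast_ord (esym (size_dual_basis C))) => i _.
      exact: cast_ordK.
    exact: cast_ordKV.
  (* Index [ord0] is the vertex [0] of the simplex, which takes the remaining weight. *)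
  exists (fun i => if unlift ord0 i is Some j then g j else 1 - \sum_k tnth t k); split.
  - move=> i; case: (unliftP ord0 i) => [j _|_]; first exact: t0.
    by rewrite subr_ge0.
  - rewrite big_ord_recl unlift_none.
    rewrite -[RHS](subrK (\sum_k tnth t k)) -(reind R (tnth t)); congr (_ + _).
    by apply: eq_bigr => i _; rewrite liftK.
  - rewrite big_ord_recl scaler0 add0r.
    rewrite -(reind N (fun k => tnth t k *: dual_mark k)).
    by apply: eq_bigr => i _; rewrite liftK -nth_dual_basis.
by rewrite lebesgue_tuple_simplex // expr1n div1r.
Qed.

(** The coordinates of [v] in the dual basis are the products with the marks, so the measured set is
    exactly [tpoly] with no facet removed. *)
Lemma lattice_volume_normal_polytope C (z : rays Sigma -> R) :
  C \in cones Sigma -> pseudocubical ip z ->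
  lattice_volume Sigma ip C (normal_polytope ip C z) =
  vol_poly ip (@cone_mark _ _ Sigma C) (fun k => z (enum_val k)) /
    (#|@cone_rays _ _ Sigma C|)`!%:R.
Proof.
move=> CS zc; rewrite lattice_volumeE.
rewrite -[RHS]/(fine (_ / _)%:E).
rewrite -(lebesgue_tpoly pred0 (cone_vertices simp CS zc) (lin_indep_cone simp CS)).
congr (fine (lebesgue_tuple _)); rewrite normal_polytopeE //.
apply/seteqP; split => t [tC tz]; split.
- by eexists; [exact: tC|move=> j; rewrite dual_sumP].
- by move=> j /=; rewrite -(dual_sumP (tnth t) j CS); exact: tz.
- have [v vC vt] := tC; rewrite (_ : \sum_k _ = v) //.
  apply/eqP; rewrite -subr_eq0; apply/eqP; apply: (lspan_orth (ip := ip) CS).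
    apply: rpredB; first exact: dual_sum_lspan.
    by apply/lspan_sub/(cone_pcone v CS).
  move=> rho /cone_mark_enum[k <-].
  by rewrite ipBl (dual_sumP (tnth t) k CS) vt subrr.
- by move=> j; rewrite dual_sumP //; exact: tz.
Qed.

Lemma cone_volume_normal_polytope C (z : rays Sigma -> R) :
  C \in cones Sigma -> pseudocubical ip z ->
  cone_volume Sigma ip C (normal_polytope ip C z) =
  vol_poly ip (@cone_mark _ _ Sigma C) (fun k => z (enum_val k)).
Proof.
move=> CS zc; rewrite /cone_volume lattice_volume_normal_polytope //.
by rewrite lattice_volume_simplex // invrK divfK // pnatr_eq0 -lt0n fact_gt0.
Qed.

End ConeVolume.

(** * Degrees in the Chow ring *)

Section FlagPolynomial.
Context {R : realType} {N : vectType R}.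
Variable ip : {dot N for @idfun R}.

(* [vol_poly] without removing used indices: projecting along [u i] replaces
   [u i] and [z i] by [0], so that the repeated terms vanish. *)
Fixpoint flag_poly (I : finType) (n : nat) (S : pred I) (u : I -> N) (z : I -> R) : R :=
  if n is m.+1 then
    \sum_(i | S i) z i * flag_poly m S (fun j => proj ip (u i) (u j))
      (fun j => z j - z i * ip (u i) (u j) / ip (u i) (u i))
  else 1.

(** Passes from sums over all rays of a cone to the shrinking index sets of [vol_poly]: [g]
    enumerates the indices not yet used, and the others in [S] have been projected to zero. *)
Lemma flag_poly_vol (I : finType) n (g : 'I_n -> I) (S : pred I) u z :
  injective g -> (forall k, S (g k)) ->
  (forall i, S i -> (forall k, g k != i) -> u i = 0 /\ z i = 0) ->
  lin_indep (u \o g) -> flag_poly n S u z = vol_poly ip (u \o g) (z \o g).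
Proof.
elim: n g u z => [|n IH] g u z ginj gS uz0 ind //=.
rewrite (bigID (mem (codom g))) /= [X in _ + X]big1 ?addr0; last first.
  move=> i /andP[Si iN]; have [|_ ->] := uz0 _ Si; last by rewrite mul0r.
  by move=> k; apply: contraNneq iN => <-; exact: codom_f.
rewrite (reindex_onto g (fun i => odflt ord0 [pick k | g k == i])) /=; last first.
  move=> i /andP[_ /codomP[k ->]]; case: pickP => [k' /eqP -> //|/(_ k)].
  by rewrite eqxx.
apply: eq_big => [k|k _].
  rewrite gS codom_f /=; case: pickP => [k' /eqP/ginj ->|/(_ k)].
    by rewrite eqxx.
  by rewrite eqxx.
have uk0 : u (g k) != 0 := lin_indep_neq0 k ind.
congr (_ * _); rewrite (IH (g \o lift k)) //.
- by move=> i j /ginj /lift_inj.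
- by move=> i; exact: gS.
- move=> i Si iN.
  have [/eqP ik|ik] := boolP (g k == i).
    rewrite -ik proj_id //; split => //.
    by rewrite mulfK ?subrr // gt_eqF // ip_gt0.
  have [|-> ->] := uz0 _ Si.
    move=> k'; case: (unliftP k k') => [j ->|->] //; exact: iN.
  by rewrite /proj ip0l ip0r mulr0 !mul0r scale0r !subr0.
- exact: (lin_indep_drop (ip := ip) (i := k) ind).
Qed.

End FlagPolynomial.

Section ChowDegree.
Context {R : realType} {N : vectType R}.
Variables (Sigma : fan N) (ip : {dot N for @idfun R}).
Hypothesis simp : simplicial Sigma.
Implicit Types (C : set N) (rho : rays Sigma) (r : seq (rays Sigma)).

Lemma chow_classZ (c : R) p : chow_class (Sigma := Sigma) (c *: p) = c *: chow_class p.
Proof. by rewrite -mul_mpolyC rmorphM. Qed.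

Lemma chow_linear_eq0 (f : N -> R) :
  (forall a x y, f (a *: x + y) = a * f x + f y) ->
  \sum_rho f (mark rho) *: chow_ray rho = 0 :> chow Sigma.
Proof.
move=> flin; pose f' : N -> R^o := f.
have f'lin : linear f' by [].
pose F : {linear N -> R^o} := HB.pack f' (GRing.isLinear.Build _ _ _ _ f' f'lin).
transitivity (chow_class (Sigma := Sigma) (\sum_rho (f (mark rho)) *: ray_var rho)).
  by rewrite rmorph_sum; apply: eq_bigr => rho _; exact/esym/chow_classZ.
apply/chow_class_eq0; exists [:: (1, \sum_rho (f (mark rho)) *: ray_var rho)].
  move=> q; rewrite inE => /eqP -> /=; right; exists (linfun F).
  by apply: eq_bigr => rho _; rewrite lfunE.
by rewrite big_seq1 mul1r.
Qed.

Lemma divisor_shift (f : N -> R) (z : rays Sigma -> R) :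
  (forall a x y, f (a *: x + y) = a * f x + f y) ->
  divisor (fun rho => z rho - f (mark rho)) = divisor z.
Proof.
move=> flin; rewrite /divisor; under eq_bigr do rewrite scalerBl.
by rewrite sumrB chow_linear_eq0 // subr0.
Qed.

Lemma chow_graded0 k : chow_graded k (0 : chow Sigma).
Proof. by exists 0; rewrite ?dhomog0 // rmorph0. Qed.

Lemma chow_gradedZ k c (a : chow Sigma) : chow_graded k a -> chow_graded k (c *: a).
Proof.
by move=> [p ph ->]; exists (c *: p); rewrite ?chow_classZ //; exact: dhomogZ.
Qed.

Lemma chow_gradedD k (a b : chow Sigma) :
  chow_graded k a -> chow_graded k b -> chow_graded k (a + b).
Proof.
by move=> [p ph ->] [q qh ->]; exists (p + q); rewrite ?rmorphD //; exact: dhomogD.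
Qed.

Lemma chow_gradedM k l (a b : chow Sigma) :
  chow_graded k a -> chow_graded l b -> chow_graded (k + l) (a * b).
Proof.
by move=> [p ph ->] [q qh ->]; exists (p * q); rewrite ?rmorphM //; exact: dhomogM.
Qed.

Lemma chow_graded_sum k (I : Type) (s : seq I) (P : pred I) (F : I -> chow Sigma) :
  (forall i, chow_graded k (F i)) -> chow_graded k (\sum_(i <- s | P i) F i).
Proof.
move=> Fk; apply: big_ind => //; first exact: chow_graded0.
by move=> a b; exact: chow_gradedD.
Qed.

Lemma chow_graded_ray rho : chow_graded 1 (chow_ray rho).
Proof.
exists (ray_var rho) => //; rewrite /ray_var dhomogX.
by rewrite /= mdeg1.
Qed.

Lemma chow_graded_rays r : chow_graded (size r) (\prod_(rho <- r) chow_ray rho).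
Proof.
elim: r => [|rho r IH].
  by rewrite big_nil; exists 1; rewrite ?rmorph1 //; exact: dhomog1.
by rewrite big_cons; apply: (chow_gradedM (k := 1)) => //; exact: chow_graded_ray.
Qed.

Lemma chow_graded_divisor (z : rays Sigma -> R) : chow_graded 1 (divisor z).
Proof. by apply: chow_graded_sum => rho; apply/chow_gradedZ/chow_graded_ray. Qed.

Lemma chow_graded_divisorX (z : rays Sigma -> R) n : chow_graded n (divisor z ^+ n).
Proof.
elim: n => [|n IH]; first by exists 1; rewrite ?rmorph1 //; exact: dhomog1.
rewrite exprS; apply: (chow_gradedM (k := 1)) => //; exact: chow_graded_divisor.
Qed.

Lemma cone_of_ray_hull r : uniq r ->
  cone_of [seq mark rho | rho <- r] = ray_hull (mem r).
Proof.
move=> ur.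
have rex (s : seq (rays Sigma)) : (0 < size s)%N -> exists rho0 : rays Sigma, True.
  by case: s => // x; exists x.
apply/seteqP; split.
  move=> v [c c0 ->]; apply: big_ind => [|x y hx hy|i _]; first exact: ray_hull0.
    by have := ray_hull_comb ler01 ler01 hx hy; rewrite !scale1r.
  have ir : (i < size r)%N by rewrite -(size_map (@mark _ _ Sigma) r).
  have [rho0 _] := rex r (leq_ltn_trans (leq0n _) ir).
  rewrite (nth_map rho0) // -[_ *: _]addr0 -(scale0r (mark (nth rho0 r i))).
  by apply: ray_hull_comb => //; apply: ray_hull_mark; exact: mem_nth.
move=> v [c [c0 cN ->]].
have -> : \sum_rho c rho *: mark rho = \sum_(rho <- r) c rho *: mark rho.
  rewrite (bigID (mem r)) /= [X in _ + X]big1 ?addr0; last first.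
    by move=> rho rr; rewrite cN // scale0r.
  by rewrite big_uniq.
have [/size0nil ->|/rex[rho0 _]] := posnP (size r).
  by rewrite big_nil; exists (fun=> 0) => //; rewrite big_ord0.
exists (fun i => c (nth rho0 r i)) => //.
rewrite (big_nth rho0) big_mkord -(size_map (@mark _ _ Sigma) r).
apply: eq_bigr => i _; rewrite (nth_map rho0) //.
by rewrite -(size_map (@mark _ _ Sigma) r).
Qed.

Lemma chow_rays_eq0 r : uniq r -> ray_hull (mem r) \notin cones Sigma ->
  \prod_(rho <- r) chow_ray rho = 0 :> chow Sigma.
Proof.
move=> ur rN; transitivity (chow_class (Sigma := Sigma) (\prod_(rho <- r) ray_var rho)).
  by rewrite rmorph_prod.
apply/chow_class_eq0; exists [:: (1, \prod_(rho <- r) ray_var rho)].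
  move=> q; rewrite inE => /eqP -> /=; left; exists r => //.
  by rewrite cone_of_ray_hull.
by rewrite big_seq1 mul1r.
Qed.

Lemma ray_hull_eq (S1 S2 : pred (rays Sigma)) : S1 =1 S2 -> ray_hull S1 = ray_hull S2.
Proof. by move=> S12; congr ray_hull; apply/funext => rho. Qed.

Lemma span_mark_sum r v : v \in <<[seq mark rho | rho <- r]>>%VS ->
  exists2 c : rays Sigma -> R, forall x, x \notin r -> c x = 0 &
    v = \sum_x c x *: mark x.
Proof.
elim: r v => [|rho r IH] v /=.
  rewrite span_nil memv0 => /eqP ->; exists (fun=> 0) => //.
  by rewrite big1 // => x _; rewrite scale0r.
rewrite span_cons => /memv_addP[_ /vlineP[a ->] [w /IH[c cN ->] ->]].
exists (fun x => a * (x == rho)%:R + c x).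
  by move=> x; rewrite inE negb_or => /andP[/negbTE -> /cN ->]; rewrite mulr0 addr0.
under [RHS]eq_bigr do rewrite scalerDl.
rewrite big_split /=; congr (_ + _); rewrite (bigD1 rho) //= eqxx mulr1 big1 ?addr0 //.
by move=> x /negbTE ->; rewrite mulr0 scale0r.
Qed.

(** Guarantees that a new ray stays nonzero after projection along the rays used before, so that
    dividing by its squared norm makes sense. *)
Lemma mark_notin_span r rho : uniq (rho :: r) ->
  ray_hull (mem (rho :: r)) \in cones Sigma ->
  mark rho \notin <<[seq mark rho | rho <- r]>>%VS.
Proof.
move=> /= /andP[rhoN ur] CS; set C := ray_hull _ in CS.
have inC x : x \in rho :: r -> cone_rays C x by exact: ray_hull_rays.
apply/negP => rs.
have [c cN cE] := span_mark_sum rs.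
have rC : cone_rays C rho by apply: inC; rewrite mem_head.
have [k kE] := cone_mark_enum rC.
have cNC x : ~~ cone_rays C x -> (x == rho)%:R - c x = 0.
  move=> xC; rewrite cN ?subr0; last first.
    by apply: contraNN xC => xr; apply: inC; rewrite inE xr orbT.
  by case: eqP => // xE; move: xC; rewrite xE rC.
have := lin_indep_cone simp CS (c := fun k => (enum_val k == rho)%:R - c (enum_val k)).
move=> /(_ _ k); rewrite kE eqxx cN // subr0 => h.
suff /h/eqP : \sum_k ((enum_val k == rho)%:R - c (enum_val k)) *:
    cone_mark (C := C) k = 0 by rewrite oner_eq0.
rewrite -(sum_cone_mark cNC); under eq_bigr do rewrite scalerBl.
rewrite sumrB -cE (bigD1 rho) //= eqxx scale1r big1 ?addr0 ?subrr //.
by move=> x /negbTE ->; rewrite scale0r.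
Qed.

End ChowDegree.

(** * Degree of a power of a divisor, cone by cone *)

Section Degree.
Context {R : realType} {N : vectType R}.
Variables (Sigma : fan N) (ip : {dot N for @idfun R}) (d : nat).
Variables (omega : cones_dim Sigma d -> R) (deg : chow Sigma -> R).
Hypothesis simp : simplicial Sigma.
Hypothesis degP : is_degree_map omega deg.
Implicit Types (C : set N) (rho : rays Sigma) (r : seq (rays Sigma)).

Lemma deg0 : deg 0 = 0.
Proof.
have [lin _] := degP; have := lin 1 0 0 (chow_graded0 _ _) (chow_graded0 _ _).
by rewrite scaler0 addr0 mul1r => /eqP; rewrite -subr_eq subrr eq_sym => /eqP.
Qed.

Lemma deg_sum (I : Type) (s : seq I) (c : I -> R) (F : I -> chow Sigma) :
  (forall i, chow_graded d (F i)) ->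
  deg (\sum_(i <- s) c i *: F i) = \sum_(i <- s) c i * deg (F i).
Proof.
move=> Fd; elim: s => [|i s IH]; first by rewrite !big_nil deg0.
have [lin _] := degP; rewrite !big_cons lin ?IH //.
by apply: chow_graded_sum => j; exact: chow_gradedZ.
Qed.

Lemma cone_of_dim (C : cones_dim Sigma d) : val C \in cones Sigma.
Proof. by have := valP C; rewrite !inE => /andP[]. Qed.

Lemma card_cone_rays (C : cones_dim Sigma d) :
  #|@cone_rays _ _ Sigma (val C)| = d.
Proof. by have := valP C; rewrite !inE => /andP[CS /eqP Cd]; rewrite -simp. Qed.

Lemma ray_hull_cone_rays (C : cones_dim Sigma d) r :
  uniq r -> size r = d -> all (cone_rays (val C)) r ->
  @cone_rays _ _ Sigma (val C) =1 mem r.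
Proof.
move=> ur sr rC.
have sub : mem r \subset @cone_rays _ _ Sigma (val C).
  by apply/fintype.subsetP => rho rr; exact: (allP rC).
have /subset_cardP/(_ sub) h : #|mem r| = #|@cone_rays _ _ Sigma (val C)|.
  by rewrite card_cone_rays -sr; apply/card_uniqP.
by move=> rho; have := h rho; rewrite /= => ->.
Qed.

(** At most one cone contributes, since [d] distinct rays exhaust those of a maximal cone. Writing
    the value as a sum over cones gives the base case of [deg_rays_divisor] its shape. *)
Lemma deg_rays r : uniq r -> size r = d ->
  deg (\prod_(rho <- r) chow_ray rho) =
  \sum_(C | all (cone_rays (val C)) r) omega C.
Proof.
move=> ur sr; have [HS|HS] := boolP (ray_hull (mem r) \in cones Sigma); last first.
  rewrite chow_rays_eq0 // deg0 big1 // => C rC.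
  case/negP: HS; apply: (ray_hull_fan simp (cone_of_dim C)) => rho rr.
  exact: (allP rC).
set H := ray_hull _ in HS.
have rH rho : rho \in r -> cone_rays H rho by exact: ray_hull_rays.
have dimH : cdim H = d.
  apply/eqP; rewrite eqn_leq; apply/andP; split.
    rewrite -sr -(size_map (@mark _ _ Sigma) r); apply: leq_trans (dim_span _).
    apply: dimvS; have [_] := lspanP H; apply => v [c [_ cN ->]].
    apply: memv_suml => rho _; have [rr|rr] := boolP (rho \in r).
      by apply/memvZ/memv_span/map_f.
    by rewrite cN // scale0r mem0v.
  rewrite simp // -sr -(card_uniqP ur); apply: subset_leq_card.
  by apply/fintype.subsetP => rho /rH.
have Hd : H \in cones_dim Sigma d by rewrite !inE HS dimH eqxx.
pose CH : cones_dim Sigma d := FSetSub Hd.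
have CHr : all (cone_rays (val CH)) r by apply/allP => rho; exact: rH.
rewrite (big_pred1 CH) => [|C /=].
  have [_ <-] := degP; congr deg; rewrite /chow_cone big_uniq //=.
  by apply: eq_bigl => rho; rewrite (ray_hull_cone_rays ur sr CHr).
apply/idP/eqP => [rC|-> //]; apply: val_inj => /=.
rewrite (cone_ray_hull (cone_of_dim C)); apply: ray_hull_eq.
exact: ray_hull_cone_rays.
Qed.

(* [f] projects along the rays of [r]; the divisor of [z] is replaced by
   linearly equivalent ones supported off the rays used so far. *)
Lemma deg_rays_divisor n r (f : N -> N) (z : rays Sigma -> R) :
  uniq r -> (size r + n)%N = d ->
  (forall a x y, f (a *: x + y) = a *: f x + f y) ->
  (forall v, v - f v \in <<[seq mark rho | rho <- r]>>%VS) ->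
  (forall rho, rho \in r -> f (mark rho) = 0 /\ z rho = 0) ->
  deg (\prod_(rho <- r) chow_ray rho * divisor z ^+ n) =
  \sum_(C | all (cone_rays (val C)) r)
    omega C * flag_poly ip n (cone_rays (val C)) (fun rho => f (mark rho)) z.
Proof.
elim: n r f z => [|n IH] r f z ur srn flin fspan fz0.
  rewrite expr0 mulr1 deg_rays ?addn0 // -?srn ?addn0 //.
  by apply: eq_bigr => C _; rewrite mulr1.
set P := \prod_(rho <- r) _.
pose u rho := f (mark rho).
(* The subtracted term is linear in the mark, so the divisor is unchanged. The new value still
   vanishes on [r], and also at [i] once [u i] is known to be nonzero. *)
pose z' i := fun rho => z rho - z i * ip (u i) (u rho) / ip (u i) (u i).
have zE i : divisor (z' i) = divisor z.
  apply: (divisor_shift (f := fun v => z i * ip (u i) (f v) / ip (u i) (u i))).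
  by move=> a x y; rewrite flin ipDr ipZr; ring.
have -> : P * divisor z ^+ n.+1 =
    \sum_i z i *: (\prod_(rho <- i :: r) chow_ray rho * divisor (z' i) ^+ n).
  rewrite exprS {1}/divisor mulr_suml mulr_sumr; apply: eq_bigr => i _.
  by rewrite zE big_cons -/P -!scalerAl -scalerAr mulrCA mulrA.
have graded i : chow_graded d (\prod_(rho <- i :: r) chow_ray rho * divisor (z' i) ^+ n).
  rewrite -srn addnS -addSn; apply: (chow_gradedM (k := size (i :: r))).
    exact: (@chow_graded_rays _ _ Sigma (i :: r)).
  exact: chow_graded_divisorX.
rewrite deg_sum //=.
under [RHS]eq_bigr do rewrite mulr_sumr.
(* Summing over rays first leaves, for each [i], the cones containing [i :: r]. The term is zero on
   both sides when [i] is already in [r] or [i :: r] spans no cone. *)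
rewrite (exchange_big_dep xpredT) //=; apply: eq_bigr => i _.
have [ir|ir] := boolP (i \in r).
  by have [_ ->] := fz0 _ ir; rewrite mul0r big1 // => C _; rewrite mul0r mulr0.
have uir : uniq (i :: r) by rewrite /= ir.
have [HS|HS] := boolP (ray_hull (mem (i :: r)) \in cones Sigma); last first.
  rewrite chow_rays_eq0 // mul0r deg0 mulr0.
  rewrite big1 // => C /andP[rC iC]; case/negP: HS.
  apply: (ray_hull_fan simp (cone_of_dim C)) => rho; rewrite /= inE.
  by move=> /orP[/eqP -> //|]; exact: (allP rC).
have iN := mark_notin_span simp uir HS.
have ui0 : u i != 0.
  apply: contraNneq iN => ui0.
  by rewrite -(subr0 (mark i)) -ui0 fspan.
have sub v : v \in <<[seq mark rho | rho <- r]>>%VS ->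
    v \in <<[seq mark rho | rho <- i :: r]>>%VS.
  by apply/subvP/sub_span => x; rewrite inE orbC => ->.
rewrite (IH (i :: r) (fun v => proj ip (u i) (f v)) (z' i)) //.
- rewrite mulr_sumr; apply: eq_big => [C|C _]; first by rewrite /= andbC.
  by rewrite mulrCA.
- by rewrite /= addSnnS.
- by move=> a x y; rewrite flin projD projZ.
- move=> v; rewrite /proj opprB addrCA.
  apply: rpredD; last exact/sub/fspan.
  apply: rpredZ; rewrite -(subKr (mark i) (u i)) rpredB //.
    by apply/memv_span; rewrite mem_head.
  exact/sub/fspan.
- move=> rho; rewrite inE => /orP[/eqP ->|rr].
    split; first exact: proj_id.
    by rewrite /z' mulfK ?subrr // gt_eqF // ip_gt0.
  have [frho zrho] := fz0 _ rr; split.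
    by rewrite frho /proj ip0l mul0r scale0r subr0.
  by rewrite /z' /u frho ip0r mulr0 mul0r subr0.
Qed.

Lemma deg_divisorX (z : rays Sigma -> R) :
  deg (divisor z ^+ d) =
  \sum_(C : cones_dim Sigma d) omega C *
    vol_poly ip (@cone_mark _ _ Sigma (val C)) (fun k => z (enum_val k)).
Proof.
have := @deg_rays_divisor d [::] id z erefl (add0n d).
rewrite big_nil mul1r => -> //; last first.
  by move=> v; rewrite subrr mem0v.
apply: eq_bigr => C _; congr (_ * _); rewrite -[X in flag_poly _ X](card_cone_rays C).
apply: (@flag_poly_vol _ _ ip _ _ (@enum_val _ (@cone_rays _ _ Sigma (val C)))).
- exact: enum_val_inj.
- by move=> k; exact: cone_rays_enum.
- by move=> rho /cone_mark_enum[k kE] /(_ k); rewrite kE eqxx.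
- exact: (lin_indep_cone simp (cone_of_dim C)).
Qed.

End Degree.

(** * Comparison of mixed volumes and mixed degrees by polarization *)

Section MixedDegree.
Context {R : realType} {N : vectType R}.
Variables (Sigma : fan N) (ip : {dot N for @idfun R}) (d : nat).
Variable omega : cones_dim Sigma d -> R.
Variable MVol : cones_dim Sigma d -> ('I_d -> set N) -> R.
Variable deg : chow Sigma -> R.
Hypothesis simp : simplicial Sigma.
Hypothesis MVolP : forall C : cones_dim Sigma d,
  is_mixed_volume (lspan (val C)) (cone_volume Sigma ip (val C)) (MVol C).
Hypothesis degP : is_degree_map omega deg.

Let value := rays Sigma -> R.
(** Polarization handles lists, mixed volumes handle families on ['I_d]; for lists of length [d] the
    default is never reached. *)
Let entry (l : seq value) (i : 'I_d) : value := nth (fun=> 0) l i.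

Lemma normal_polytope_in (C : cones_dim Sigma d) (z : value) : pseudocubical ip z ->
  polytope (normal_polytope ip (val C) z) /\
  forall v, normal_polytope ip (val C) z v -> v \in lspan (val C).
Proof.
move=> zc; have CS := cone_of_dim C; split.
  rewrite normal_polytopeE //.
  exact: (normal_poly_polytope (cone_vertices simp CS zc)).
by move=> v [Cv _]; exact: lspan_sub.
Qed.

Lemma normal_polytope_comb (C : cones_dim Sigma d) a b (z1 z2 : value) : 0 <= a -> 0 <= b ->
  pseudocubical ip z1 -> pseudocubical ip z2 ->
  minkowski_comb a b (normal_polytope ip (val C) z1) (normal_polytope ip (val C) z2)
  = normal_polytope ip (val C) (val_comb a b z1 z2).
Proof.
move=> a0 b0 c1 c2; have CS := cone_of_dim C; rewrite !normal_polytopeE //.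
exact: (normal_poly_minkowski a0 b0 (cone_vertices simp CS c1) (cone_vertices simp CS c2)).
Qed.

Lemma divisor_comb a b (z1 z2 : value) :
  divisor (val_comb a b z1 z2) = a *: divisor z1 + b *: divisor z2.
Proof.
rewrite /divisor !scaler_sumr -big_split; apply: eq_bigr => rho _.
by rewrite /= !scalerA -scalerDl.
Qed.

Let defect (l : seq value) : R :=
  fan_mixed_volume ip omega MVol (entry l) - deg (\prod_(z <- l) divisor z).

Let K (z : value) : Prop := pseudocubical ip z.

Lemma entryK l i : {in l, forall z, K z} -> size l = d -> K (entry l i).
Proof. by move=> Kl sl; apply: Kl; rewrite mem_nth // sl. Qed.

Lemma defect_perm l l' : {in l, forall z, K z} -> size l = d ->
  perm_eq l l' -> defect l = defect l'.
Proof.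
move=> Kl sl ll'; rewrite /defect (perm_big _ ll'); congr (_ - _).
have sl' : size l' == d by rewrite -sl (perm_size ll').
have : perm_eq l (Tuple sl') by [].
move=> /tuple_permP[p lE]; apply: eq_bigr => C _; congr (_ * _).
have [MVperm _ _] := MVolP C.
rewrite -(MVperm (fun i => normal_polytope ip (val C) (entry l' i)) p).
  congr (MVol C); apply/funext => i /=; congr normal_polytope.
  rewrite /entry lE (nth_map i) ?size_enum_ord // nth_ord_enum.
  by rewrite (tnth_nth (fun=> 0)).
move=> i; apply: normal_polytope_in; apply: entryK; last exact/eqP.
by move=> x xl; apply: Kl; rewrite (perm_mem ll').
Qed.

Lemma defect_comb k x y l : 0 <= k -> K x -> K y -> {in l, forall z, K z} ->
  (size l).+1 = d ->
  defect (val_comb 1 k x y :: l) = defect (x :: l) + k * defect (y :: l).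
Proof.
move=> k0 Kx Ky Kl sl.
have d0 : (0 < d)%N by rewrite -sl.
pose i0 := Ordinal d0.
have vol_comb : fan_mixed_volume ip omega MVol (entry (val_comb 1 k x y :: l)) =
    fan_mixed_volume ip omega MVol (entry (x :: l)) +
    k * fan_mixed_volume ip omega MVol (entry (y :: l)).
  rewrite /fan_mixed_volume mulr_sumr -big_split; apply: eq_bigr => C _ /=.
  have [_ MVlin _] := MVolP C.
  pose Q (z : value) := normal_polytope ip (val C) z.
  have PE z : (fun i => Q (entry (z :: l) i)) =
      (fun j => if j == i0 then Q z else Q (entry (x :: l) j)).
    apply/funext => j; rewrite -val_eqE /entry /=.
    by case: (val j).
  rewrite -/Q !PE mulrCA -mulrDr; congr (_ * _).
  rewrite /Q -normal_polytope_comb // MVlin ?mul1r //; try exact: normal_polytope_in.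
  move=> j; apply: normal_polytope_in; apply: entryK => //=.
  by move=> w; rewrite inE => /orP[/eqP ->|/Kl].
have deg_comb : deg (\prod_(z <- val_comb 1 k x y :: l) divisor z) =
    deg (\prod_(z <- x :: l) divisor z) + k * deg (\prod_(z <- y :: l) divisor z).
  have graded z : chow_graded d (\prod_(w <- z :: l) divisor w).
    rewrite -sl -[(size l).+1]/(size (z :: l)).
    elim: (z :: l) => [|w s IH].
      by rewrite big_nil -(expr0 (divisor z)); exact: chow_graded_divisorX.
    rewrite big_cons; apply: (chow_gradedM (k := 1)) => //.
    exact: chow_graded_divisor.
  have [lin _] := degP; rewrite addrC -lin //; congr deg.
  by rewrite !big_cons divisor_comb scale1r mulrDl addrC -scalerAl.
rewrite /defect vol_comb deg_comb; ring.
Qed.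

Lemma defect_diag x : K x -> defect (nseq d x) = 0.
Proof.
move=> Kx; have dE : entry (nseq d x) = (fun=> x).
  by apply/funext => i; rewrite /entry nth_nseq ltn_ord.
rewrite /defect dE big_nseq iter_mulr_1 (deg_divisorX ip simp degP).
apply/eqP; rewrite subr_eq0; apply/eqP; apply: eq_bigr => C _; congr (_ * _).
have [_ _ ->] := MVolP C; last exact: normal_polytope_in.
apply: cone_volume_normal_polytope => //. exact: cone_of_dim.
Qed.

Lemma fan_mixed_volume_deg (z : 'I_d -> value) :
  (forall i, pseudocubical ip (z i)) ->
  fan_mixed_volume ip omega MVol z = deg (\prod_(i < d) divisor (z i)).
Proof.
move=> zc; pose l := [tuple z i | i < d].
have le : entry l = z.
  by apply/funext => i; rewrite /entry -tnth_nth tnth_mktuple.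
have Kl : {in (l : seq value), forall x, K x}.
  by move=> x /mapP[i _ ->]; exact: zc.
have := @polarization_eq0 R _ K (fun k x y => val_comb 1 k x y) d defect _ _ _
  (fun=> 0) _ _ l Kl (size_tuple l).
rewrite /defect le big_map big_enum /= => h; apply/eqP; rewrite -subr_eq0.
apply/eqP; apply: h.
- by move=> k x y k0 Kx Ky; exact: pseudocubical_comb.
- exact: defect_perm.
- exact: defect_comb.
- exact: pseudocubical0.
- exact: defect_diag.
Qed.

End MixedDegree.

Theorem theorem3p6 (R : realType) (N : vectType R) (Sigma : fan N) (d : nat)
    (omega : cones_dim Sigma d -> R) (Sigma_tropical : tropical omega)
    (ip : {dot N for @idfun R})
    (MVol : cones_dim Sigma d -> ('I_d -> set N) -> R)
    (MVolP : forall C : cones_dim Sigma d,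
       is_mixed_volume (lspan (val C)) (cone_volume Sigma ip (val C)) (MVol C))
    (deg : chow Sigma -> R) (degP : is_degree_map omega deg)
    (z : 'I_d -> rays Sigma -> R) (z_cub : forall i, pseudocubical ip (z i)) :
  fan_mixed_volume ip omega MVol z = deg (\prod_(i < d) divisor (z i)).
Proof.
have [_ simp _ _] := Sigma_tropical.
exact: fan_mixed_volume_deg simp MVolP degP _ z_cub.
Qed.
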